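(* Let $\{(X(t),Y(t))\}_{t\ge0}$ be a standard orthogonal planar random motion with speed $c>0$ and rate function $\lambda(t)\in C^2\bigl((0,\infty),[0,\infty)\bigr)$, and let $Z(t)=|X(t)|+|Y(t)|$. Let $\{U(t)\}_{t\ge0}$ and $\{V(t)\}_{t\ge0}$ be two independent one-dimensional telegraph processes with parameters $(c/2,\lambda(t)/2)$, and let $p_U(\cdot,t)$, $p_V(\cdot,t)$ be the densities of the absolutely continuous components of the laws of $U(t)$, $V(t)$. Then, for $z\in[0,ct)$, $$P\{Z(t)\in dz\}/dz=4\,p_U\Bigl(\frac z2,t\Bigr)\int_0^{z/2}p_V(w,t)\,dw,$$ and, for $\beta\in[0,ct]$, $$P\Bigl\{\max_{0\le s\le t}Z(s)\le\beta\Bigr\}=P\Bigl\{\max_{0\le s\le t}|U(s)|\le\beta/2\Bigr\}^2.$$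
   Context: Directions: $d_k=(\cos(k\pi/2),\sin(k\pi/2))$, $k=0,1,2,3$, with indices taken modulo 4. Let $\{N(t)\}_{t\ge0}$ be a non-homogeneous Poisson process with rate function $\lambda(t)$. The standard orthogonal planar random motion with speed $c$ and rate function $\lambda$ is the position $(X(t),Y(t))$ of a particle that starts at the origin at time $0$ with initial direction uniformly distributed on $\{d_0,d_1,d_2,d_3\}$, moves with velocity $c\,d_k$ as long as its current direction is $d_k$, and at each event of $N$ switches from its current direction $d_k$ to $d_{k+1}$ or $d_{k-1}$, each with probability $1/2$ (independently of everything else). A one-dimensional (symmetric) telegraph process with parameters $(v,\mu(t))$, i.e. velocity $v>0$ and rate function $\mu(t)$, is the position of a particle on $\mathbb{R}$ starting at $0$ with initial velocity $+v$ or $-v$, each with probability $1/2$, and reversing its velocity at each event of an independent non-homogeneous Poisson process with rate function $\mu(t)$. *)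

(* Defs.v *)
From HB Require Import structures.
From mathcomp Require Export all_boot all_order all_algebra finmap.
From mathcomp Require Export all_classical all_reals all_analysis.

Set Implicit Arguments.
Unset Strict Implicit.
Unset Printing Implicit Defensive.

Export Order.TTheory GRing.Theory Num.Theory.
Export numFieldNormedType.Exports.

Global Open Scope classical_set_scope.
Global Open Scope ring_scope.

(* Processes are functions [X : R -> T -> S]; only times [t >= 0] are
   meaningful, the values at negative times are never constrained or used. *)

Definition mutually_independent (R : realType) (d : measure_display)
    (T : measurableType d) (P : probability T R) (I : choiceType)
    (F : I -> set (set T)) : Prop :=
  forall (J : {fset I}) (E : I -> set T),
    (forall i, i \in J -> F i (E i)) ->
    P (\bigcap_(i in [set` J]) E i) = (\prod_(i <- J) P (E i))%E.

Definition process_sigma_algebra (R : realType) (d d' : measure_display)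
    (T : measurableType d) (S : measurableType d') (X : R -> T -> S) :
    set (set T) :=
  <<s \bigcup_(t in [set t : R | 0 <= t]) g_sigma_algebra_preimage (X t) >>.

Definition independent_processes (R : realType) (d : measure_display)
    (T : measurableType d) (P : probability T R) (U V : R -> T -> R) : Prop :=
  mutually_independent P (fun b : bool =>
    if b then process_sigma_algebra U else process_sigma_algebra V).

(* Integrability of the rate on every [0, t] is part of the notion: it says that
   the mean of [N t] is finite, which smoothness on ]0, +oo[ does not imply.
   The second argument of [poisson_prob] is a dummy. *)
Definition is_poisson_process (R : realType) (d : measure_display)
    (T : measurableType d) (P : probability T R) (rate : R -> R)
    (N : R -> T -> nat) : Prop :=
  (forall t : R, 0 <= t ->
     lebesgue_measure.-integrable `[0, t] (fun s => (rate s)%:E)) /\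
  (forall t : R, 0 <= t -> measurable_fun [set: T] (N t)) /\
  (forall w, N 0 w = 0%N) /\
  (forall (w : T) (s t : R), 0 <= s -> s <= t -> (N s w <= N t w)%N) /\
  (forall (w : T) (t : R), 0 <= t -> \forall s \near t^'+, N s w = N t w) /\
  (forall tau : nat -> R, 0 <= tau 0%N ->
     (forall i j, (i <= j)%N -> tau i <= tau j) ->
     mutually_independent P (fun i : nat =>
       g_sigma_algebra_preimage
         (fun w => (N (tau i.+1) w - N (tau i) w)%N))) /\
  (forall s t : R, 0 <= s -> s <= t -> forall A : set nat,
     P [set w | A (N t w - N s w)%N] =
     poisson_prob (\int[lebesgue_measure]_(u in `[s, t]) rate u) 0%N A).

Definition is_fair_coin (R : realType) (d : measure_display)
    (T : measurableType d) (P : probability T R) (b : T -> bool) : Prop :=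
  measurable_fun [set: T] b /\ forall e : bool, P (b @^-1` [set e]) = (2^-1)%:E.

Definition is_telegraph_process (R : realType) (d : measure_display)
    (T : measurableType d) (P : probability T R) (v : R) (rate : R -> R)
    (U : R -> T -> R) : Prop :=
  exists (e : T -> bool) (N : R -> T -> nat),
    is_fair_coin P e /\
    is_poisson_process P rate N /\
    mutually_independent P (fun b : bool =>
      if b then g_sigma_algebra_preimage e else process_sigma_algebra N) /\
    forall (t : R) (w : T), 0 <= t ->
      U t w = \int[lebesgue_measure]_(s in `[0, t])
                (v * (-1) ^+ (e w + N s w)).

(* [direction k] is d_k; ['Z_4] carries the arithmetic of indices modulo 4. *)
Definition direction (R : realType) (k : 'Z_4) : R * R :=
  (cos ((k : nat)%:R * pi / 2), sin ((k : nat)%:R * pi / 2)).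

(* Index of the direction after [n] events: [k0] is the initial index and the
   coin [xi i] decides between +1 and -1 at the event number [i + 1]. *)
Fixpoint direction_index (T : Type) (k0 : T -> 'Z_4) (xi : nat -> T -> bool)
    (n : nat) (w : T) : 'Z_4 :=
  if n is m.+1 then
    direction_index k0 xi m w + (if xi m w then 1 else - 1)
  else k0 w.

Definition is_orthogonal_planar_motion (R : realType) (d : measure_display)
    (T : measurableType d) (P : probability T R) (c : R) (rate : R -> R)
    (X Y : R -> T -> R) : Prop :=
  exists (N : R -> T -> nat) (k0 : T -> 'Z_4) (xi : nat -> T -> bool),
    is_poisson_process P rate N /\
    (forall k : 'Z_4, measurable (k0 @^-1` [set k]) /\
                      P (k0 @^-1` [set k]) = (4^-1)%:E) /\
    (forall n, is_fair_coin P (xi n)) /\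
    mutually_independent P (fun i : bool + nat =>
      match i with
      | inl true => process_sigma_algebra N
      | inl false => preimage_set_system setT k0 [set: set 'Z_4]
      | inr n => g_sigma_algebra_preimage (xi n)
      end) /\
    forall (t : R) (w : T), 0 <= t ->
      X t w = \int[lebesgue_measure]_(s in `[0, t])
                (c * (direction R (direction_index k0 xi (N s w) w)).1) /\
      Y t w = \int[lebesgue_measure]_(s in `[0, t])
                (c * (direction R (direction_index k0 xi (N s w) w)).2).

Definition l1_distance (R : realType) (T : Type) (X Y : R -> T -> R) :
    R -> T -> R :=
  fun t w => `|X t w| + `|Y t w|.

(* The paths to which this is applied are continuous, so that the supremum over
   [0, t] is finite and attained. *)
Definition running_max (R : realType) (T : Type) (Z : R -> T -> R) (t : R)
    (w : T) : R :=
  sup [set Z s w | s in `[0, t]].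

(* [p] is a density of the absolutely continuous component in the Lebesgue
   decomposition of the law of [X]. *)
Definition is_ac_density (R : realType) (d : measure_display)
    (T : measurableType d) (P : probability T R) (X : T -> R) (p : R -> R) :
    Prop :=
  measurable_fun [set: R] p /\ (forall x, 0 <= p x) /\
  exists nu : {measure set R -> \bar R},
    (exists S : set R, [/\ measurable S, lebesgue_measure S = 0%E
                         & nu (~` S) = 0%E]) /\
    forall A : set R, measurable A ->
      P (X @^-1` A) =
        (\int[lebesgue_measure]_(x in A) (p x)%:E + nu A)%E.

(* On [D], the law of [X] is [f x dx]. *)
Definition has_density_on (R : realType) (d : measure_display)
    (T : measurableType d) (P : probability T R) (X : T -> R) (D : set R)
    (f : R -> R) : Prop :=
  measurable_fun D f /\ (forall x, D x -> 0 <= f x) /\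
  forall A : set R, measurable A -> A `<=` D ->
    P (X @^-1` A) = (\int[lebesgue_measure]_(x in A) (f x)%:E)%E.

Definition C2_on_positive (R : realType) (f : R -> R) : Prop :=
  forall t : R, 0 < t ->
    [/\ derivable f t 1, derivable (f^`())%classic t 1
      & {for t, continuous (f^`(2))%classic}].

(* Main.v *)
From HB Require Import structures.
Require Import Defs.
From mathcomp Require Import measurable_realfun zify ring lra.

Set Implicit Arguments.
Unset Strict Implicit.
Unset Printing Implicit Defensive.

(** The four directions are the four sign patterns of [(x + y, x - y)], and a
    quarter turn in either sense reverses exactly one of the two signs, the
    fair coin choosing which.  So [(X + Y) / 2] and [(X - Y) / 2] are driven by
    the two halves of a thinned Poisson process: they behave as two independent
    telegraph processes of speed [c / 2] and rate [lambda / 2].  As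
    [|x| + |y| = max (|x + y|, |x - y|)], the value [Z t] is twice the larger of
    their absolute values.  Hence the distribution functions of [Z t] and of its
    running maximum at [b] are the squares of those of [|U t|] and of the running
    maximum of [|U|] at [b / 2] ([square_distribution]).

    The laws are identified on the grid of mesh [t / (n + 1)].  On a cell where
    the rate has integral [a] each of the two signs flips with probability
    [(1 - exp (- a)) / 2], independently of the other sign and of the other
    cells ([planar_pattern_law]); the parity of a Poisson variable of mean
    [a / 2] has the same law ([telegraph_pattern_law]).  A path with [N t] events
    is within [O (N t / n)] of the Riemann sum of its velocity
    ([counting_path_riemann]), so that the values and the running maxima of the
    discretized paths converge pointwise, and an identity between distribution
    functions passes to the limit ([distribution_limit_transfer]).

    For the density, the singular component of the law of [U t] must not charge
    the open interval from [- c t / 2] to [c t / 2] ([telegraph_null]).  Moving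
    the last flip along the grid moves the end point with constant speed, and
    creating that flip costs a factor [K h], with [h] the mesh and [K] a bound of
    the rate; so an interval of length [l] has a mass [O (l)] as long as the last
    flip is away from time [0], where the rate may be unbounded
    ([pattern_mass_interval]).  A path that ends away from the extreme points
    does have a flip away from time [0].  Then [P (|U t| <= x)] is twice the
    integral of the density over [[0, x]] by symmetry ([telegraph_half_line]),
    its square is the integral of the announced density by Tonelli's theorem
    ([integral_square_density]), and the law on the interval from [0] to [c t]
    is determined by its distribution function
    ([law_density_of_distribution]). *)

(** * Parity of a Poisson variable *)

Lemma cvg_sum_expR (R : realType) (x : R) :
  (fun n => \sum_(0 <= k < n) (x ^+ k / k`!%:R)) @ \oo --> expR x.
Proof.
have := @is_cvg_series_exp_coeff R x.
by rewrite expRE exp_coeffE /pseries /series /=; under eq_fun do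
  under eq_bigr do rewrite mulrC.
Qed.

(** Twice the indicator of odd [k] is [1 - (-1)^k]; so the mass of the odd
    integers is, up to the factor [exp (- a) / 2], the difference of the
    exponential series at [a] and at [- a]. *)
Lemma poisson_prob_odd (R : realType) (a : R) (k0 : nat) : 0 <= a ->
  poisson_prob a k0 [set k | odd k] = ((1 - expR (- (a *+ 2))) / 2)%:E.
Proof.
rewrite le_eqVlt => /predU1P[<-|a0].
  rewrite /poisson_prob ltxx mul0rn oppr0 expR0 subrr mul0r diracE.
  by rewrite memNset.
rewrite /poisson_prob a0 -nneseries_esum; last first.
  by move=> n _; rewrite lee_fin poisson_pmf_ge0.
under eq_eseriesr do rewrite /poisson_pmf a0.
have cv : (fun n => \sum_(0 <= k < n | odd k) (a ^+ k / k`!%:R * expR (- a)))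
    @ \oo --> (expR a - expR (- a)) * (expR (- a) / 2).
  have h := cvgM (cvgB (@cvg_sum_expR R a) (@cvg_sum_expR R (- a)))
    (@cvg_cst _ (expR (- a) / 2) _ (\oo : set_system nat) _).
  rewrite [X in X @ _](_ : _ = ((fun n => \sum_(0 <= k < n) (a ^+ k / k`!%:R)) -
    (fun n => \sum_(0 <= k < n) ((- a) ^+ k / k`!%:R)))
    \* cst (expR (- a) / 2)); first exact: h.
  apply/funext => n; rewrite /= !fctE -sumrB mulr_suml big_mkcond.
  apply: eq_bigr => k _.
  by rewrite [(- a) ^+ k]exprNn -signr_odd; case: (odd k); field.
transitivity (((expR a - expR (- a)) * (expR (- a) / 2))%:E).
  apply/cvg_lim => //; under eq_fun do rewrite sumEFin.
  by apply: cvg_EFin cv; exact: nearW.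
by congr EFin; rewrite mulr2n opprD expRD mulrA mulrBl expRxMexpNx_1.
Qed.

Lemma poisson_prob_zero (R : realType) (a : R) (k0 : nat) : 0 <= a ->
  poisson_prob a k0 [set 0%N] = (expR (- a))%:E.
Proof.
rewrite le_eqVlt => /predU1P[<-|a0].
  by rewrite /poisson_prob ltxx oppr0 expR0 diracE mem_set.
rewrite /poisson_prob a0 esum_set1 ?lee_fin ?poisson_pmf_ge0//.
by rewrite /poisson_pmf a0 expr0 fact0 invr1 !mul1r.
Qed.

(** * Independence and partitions *)

Lemma mutually_independent_seq (R : realType) (d : measure_display)
    (T : measurableType d) (P : probability T R) (I : choiceType)
    (F : I -> set (set T)) (s : seq I) (E : I -> set T) :
  mutually_independent P F -> uniq s -> (forall i, i \in s -> F i (E i)) ->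
  P (\bigcap_(i in [set` s]) E i) = (\prod_(i <- s) P (E i))%E.
Proof.
move=> indep us FE; pose J := [fset i in s]%fset.
have Js : perm_eq J s.
  by apply: uniq_perm => // i; rewrite !inE.
rewrite -(perm_big _ Js) -indep => [|i]; last by rewrite !inE; exact: FE.
by congr (P _); apply: eq_bigcapl; split=> i /=; rewrite !inE.
Qed.

(** Conditioning on a countably valued variable: the event [E] has the same
    conditional probability [g] given each of the values in [C]. *)
Lemma measure_countable_mixture (R : realType) (d : measure_display)
    (T : measurableType d) (P : probability T R) (K : countType) (nu : T -> K)
    (E : set T) (C : set K) (g : R) : 0 <= g ->
  (forall k, measurable (nu @^-1` [set k])) ->
  (forall k, C k -> measurable (E `&` nu @^-1` [set k]) /\
     P (E `&` nu @^-1` [set k]) = (g%:E * P (nu @^-1` [set k]))%E) ->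
  measurable (E `&` nu @^-1` C) /\
  P (E `&` nu @^-1` C) = (g%:E * P (nu @^-1` C))%E.
Proof.
move=> g0 mnu gE.
pose D (A : set T) j := [set w | [/\ A w, C (nu w) & choice.pickle (nu w) = j]].
have D_cup A : A `&` nu @^-1` C = \bigcup_j D A j.
  by apply/seteqP; split=> [w [Aw Cw]|w [j _ []]//]; exists (choice.pickle (nu w)).
have D_val j : (exists2 k, C k & forall A, D A j = A `&` nu @^-1` [set k]) \/
    forall A, D A j = set0.
  have [[k Ck kj]|nk] := pselect (exists2 k, C k & choice.pickle k = j).
    left; exists k => // A; apply/seteqP; split=> w /=.
      by move=> [Aw Cw]; rewrite -kj => /(pcan_inj choice.pickleK).
    by move=> [Aw nuw]; split; rewrite ?nuw.
  by right=> A; apply/seteqP; split=> // w [Aw Cw wj]; apply: nk; exists (nu w).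
have D_triv A : trivIset setT (D A).
  by apply/trivIsetP => i j _ _ /eqP ij; apply/seteqP; split=> // w
    [[_ _ wi] [_ _ wj]]; apply: ij; rewrite -wi.
have mDE j : measurable (D E j).
  by have [[k Ck ->]|->] := D_val j; [exact: (gE k Ck).1|exact: measurable0].
have mDT j : measurable (D setT j).
  by have [[k Ck ->]|->] := D_val j; [rewrite setTI|exact: measurable0].
split; first by rewrite D_cup; exact: bigcup_measurable.
rewrite -[X in (_ * P X)%E]setTI !D_cup !measure_bigcup// -nneseriesZl//.
apply: eq_eseriesr => j _.
have [[k Ck Dk]|D0] := D_val j; last by rewrite !D0 measure0 mule0.
by rewrite (Dk E) (Dk setT) setTI; exact: (gE k Ck).2.
Qed.

Lemma measure_finite_partition (R : realType) (d : measure_display)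
    (T : measurableType d) (P : probability T R) (F : finType) (nu : T -> F)
    (E : set T) :
  (forall f, measurable (E `&` nu @^-1` [set f])) ->
  measurable E /\ P E = (\sum_f P (E `&` nu @^-1` [set f]))%E.
Proof.
move=> mE; have E_cup : E = \bigcup_f (E `&` nu @^-1` [set f]).
  by apply/seteqP; split=> [w Ew|w [f _ []]//]; exists (nu w).
split.
  by rewrite E_cup; apply: fin_bigcup_measurable => // f _; exact: finite_finset.
rewrite {1}E_cup measure_fin_bigcup//=.
- rewrite (fsbigE (index_enum F)) ?index_enum_uniq//=.
    by apply: eq_bigl => f; rewrite in_setT.
  by move=> f _; rewrite mem_index_enum.
- by apply/trivIsetP => f g _ _ /eqP fg; apply/seteqP; split=> // w
    [[_ wf] [_ wg]]; apply: fg; rewrite -wf.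
Qed.

(** * Means over fair coins *)

(** Coins are peeled off from the front, so that means over successive blocks
    of coins compose ([coin_mean_cat]). *)
Fixpoint coin_mean (R : realType) (K : nat) (F : seq bool -> R) : R :=
  if K is K'.+1 then
    (coin_mean K' (fun u => F (true :: u)) +
     coin_mean K' (fun u => F (false :: u))) / 2
  else F [::].

Lemma eq_coin_mean (R : realType) (K : nat) (F G : seq bool -> R) :
  (forall u, size u = K -> F u = G u) -> coin_mean K F = coin_mean K G.
Proof.
elim: K F G => [|K IH] F G FG /=; first exact: FG.
by congr ((_ + _) / 2); apply: IH => u su; apply: FG; rewrite /= su.
Qed.

Lemma coin_mean_scale (R : realType) (K : nat) (c : R) (F : seq bool -> R) :
  coin_mean K (fun u => c * F u) = c * coin_mean K F.
Proof.
elim: K F => [//|K IH] F /=; rewrite !IH; lra.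
Qed.

Lemma coin_mean_cat (R : realType) (K L : nat) (F : seq bool -> R) :
  coin_mean (K + L) F = coin_mean K (fun u => coin_mean L (fun v => F (u ++ v))).
Proof.
by elim: K F => [//|K IH] F; rewrite addSn /= !IH.
Qed.

(** Hypothesis [cyl] says that the coins are fair and independent of [B], an
    event of probability [b]; the coins are revealed one by one after a
    prefix [p]. *)
Lemma coin_mean_event (R : realType) (d : measure_display)
    (T : measurableType d) (P : probability T R) (B : set T)
    (xi : nat -> T -> bool) (b : R) :
  (forall p : seq bool,
     let C := [set w | B w /\ mkseq (xi^~ w) (size p) = p] in
     measurable C /\ P C = (b / 2 ^+ size p)%:E) ->
  forall (K : nat) (G : seq bool -> bool),
  let C := [set w | B w /\ G (mkseq (xi^~ w) K)] in
  measurable C /\ P C = (b * coin_mean K (fun u => (G u)%:R))%:E.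
Proof.
move=> cyl K G.
suff H p : let C := [set w | [/\ B w, mkseq (xi^~ w) (size p) = p &
      G (mkseq (xi^~ w) (size p + K))]] in
    measurable C /\
    P C = (b / 2 ^+ size p * coin_mean K (fun u => (G (p ++ u))%:R))%:E.
  have := H [::]; rewrite /= expr0 divr1 add0n.
  rewrite (_ : [set w | _] = [set w | B w /\ G (mkseq (xi^~ w) K)])//.
  by apply/seteqP; split=> w /= []; [|split].
elim: K p => [|K IH] p /=.
  rewrite addn0 cats0; have [Gp|nGp] := boolP (G p).
    rewrite mulr1 (_ : [set w | _] = [set w | B w /\ mkseq (xi^~ w) (size p) = p]).
      exact: cyl.
    by apply/seteqP; split=> w /= [] // Bw ->.
  rewrite mulr0 (_ : [set w | _] = set0) ?measure0; first by split.
  by apply/seteqP; split=> // w [_ ->]; rewrite (negPf nGp).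
have {IH} := (IH (rcons p true), IH (rcons p false)).
rewrite /= !size_rcons => -[[mt Pt] [mf Pf]].
set Ct := (X in measurable X) in mt; set Cf := (X in measurable X) in mf.
rewrite (_ : [set w | _] = Ct `|` Cf).
  split; first exact: measurableU.
  rewrite measureU//; last first.
    apply/seteqP; split=> // w [[_ + _] [_ + _]].
    by rewrite !mkseqS => /rcons_inj[_ ->] /rcons_inj[_].
  transitivity (P Ct + P Cf)%E => //.
  rewrite Pt Pf -EFinD exprS; congr EFin.
  under [in RHS]eq_coin_mean do rewrite -cat_rcons.
  under [X in _ = _ * ((_ + X) / 2)]eq_coin_mean do rewrite -cat_rcons.
  by field.
apply/seteqP; split=> w /=.
  rewrite addnS => -[Bw pw Gw]; case xw : (xi (size p) w); [left|right].
    by split=> //; rewrite mkseqS pw xw.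
  by split=> //; rewrite mkseqS pw xw.
by rewrite addnS => -[] [Bw]; rewrite mkseqS => /rcons_inj[pw _] Gw.
Qed.

(** * The walk on the directions *)

Definition walk_step (a : 'Z_4) (b : bool) : 'Z_4 := a + (if b then 1 else - 1).

Definition walk (a : 'Z_4) (u : seq bool) : 'Z_4 := foldl walk_step a u.

Lemma direction_indexE (T : Type) (k0 : T -> 'Z_4) (xi : nat -> T -> bool)
    (n : nat) (w : T) :
  direction_index k0 xi n w = walk (k0 w) (mkseq (xi^~ w) n).
Proof.
by elim: n => [//|n IH]; rewrite mkseqS /walk foldl_rcons /= IH.
Qed.

(** Only the parity of the number of steps matters, except that a walk of
    length [0] does not move. *)
Definition hit_prob (R : realType) (k : nat) (a b : 'Z_4) : R :=
  if k is 0 then (a == b)%:R else (odd (b - a)%R == odd k)%:R / 2.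

Lemma Z4_cases (Q : 'Z_4 -> Prop) : Q 0 -> Q 1 -> Q (1 + 1) -> Q (- 1) ->
  forall a, Q a.
Proof.
move=> Q0 Q1 Q2 Q3 a.
have : [\/ a = 0, a = 1, a = 1 + 1 | a = - 1].
  case: a => [[|[|[|[|//]]]] lt]; [apply: Or41|apply: Or42|apply: Or43|apply: Or44];
  exact: val_inj.
by case=> ->.
Qed.

Lemma hit_prob_step (R : realType) (k : nat) (a b : 'Z_4) :
  (hit_prob R k (walk_step a true) b + hit_prob R k (walk_step a false) b) / 2 =
  hit_prob R k.+1 a b.
Proof.
case: k => [|k]; rewrite /hit_prob /walk_step /=.
  by elim/Z4_cases: a; elim/Z4_cases: b; rewrite /= ?addr0 ?add0r.
by case: (odd k); elim/Z4_cases: a; elim/Z4_cases: b => /=; lra.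
Qed.

Lemma coin_mean_hit (R : realType) (k : nat) (a b : 'Z_4) :
  coin_mean k (fun u => (walk a u == b)%:R) = hit_prob R k a b.
Proof.
by elim: k a => [//|k IH] a; rewrite -hit_prob_step -!IH.
Qed.

Definition walk_hits (n : nat -> nat) (kappa : nat -> 'Z_4) (a : 'Z_4) (m : nat)
    (u : seq bool) : bool :=
  all (fun i => walk a (take (n i) u) == kappa i) (iota 0 m.+1).
Arguments walk_hits : simpl never.

Lemma walk_hitsS (n : nat -> nat) (kappa : nat -> 'Z_4) (a : 'Z_4) (m : nat)
    (u : seq bool) :
  walk_hits n kappa a m.+1 u =
  walk_hits n kappa a m u && (walk a (take (n m.+1) u) == kappa m.+1).
Proof. by rewrite /walk_hits -[in LHS](addn1 m.+1) iotaD all_cat /= andbT. Qed.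

(** Successive blocks use disjoint sets of coins and the position at the end
    of a block is prescribed, so that the next block starts afresh. *)
Lemma coin_mean_walk (R : realType) (n : nat -> nat) (kappa : nat -> 'Z_4)
    (a : 'Z_4) (m : nat) :
  n 0%N = 0%N -> {homo n : i j / (i <= j)%N} ->
  coin_mean (n m) (fun u => (walk_hits n kappa a m u)%:R) =
  (a == kappa 0%N)%:R *
    \prod_(i < m) hit_prob R (n i.+1 - n i) (kappa i) (kappa i.+1).
Proof.
move=> n0 n_le; elim: m => [|m IH].
  by rewrite n0 big_ord0 mulr1 /walk_hits /= andbT.
rewrite big_ord_recr mulrA -IH /= -coin_mean_hit [RHS]mulrC.
have nS := subnKC (n_le _ _ (leqnSn m)); move: (n m.+1 - n m)%N nS => k nS.
rewrite -nS coin_mean_cat -coin_mean_scale.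
apply: eq_coin_mean => u su; rewrite mulrC -coin_mean_scale.
apply: eq_coin_mean => v sv; rewrite -natrM mulnb; congr (nat_of_bool _)%:R.
rewrite walk_hitsS take_oversize ?size_cat ?su ?sv ?nS// [walk a (u ++ v)]/walk foldl_cat.
rewrite -/(walk a u).
have -> : walk_hits n kappa a m (u ++ v) = walk_hits n kappa a m u.
  apply: eq_in_all => i; rewrite mem_iota add0n ltnS => im.
  by rewrite takel_cat// su n_le.
rewrite /walk_hits; case: allP => // /(_ m); rewrite mem_iota ltnS leqnn.
move=> /(_ isT) /eqP.
by rewrite take_oversize ?su// => ->.
Qed.

(** * Poisson counts on a grid *)

Definition cell_mean (R : realType) (rate : R -> R) (h : R) (i : nat) : R :=
  \int[lebesgue_measure]_(u in `[i%:R * h, i.+1%:R * h]) rate u.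

Lemma poisson_counts_measurable (R : realType) (d : measure_display)
    (T : measurableType d) (P : probability T R) (rate : R -> R)
    (N : R -> T -> nat) (h : R) (m : nat) (s : seq nat) :
  is_poisson_process P rate N -> 0 <= h ->
  measurable [set w | mkseq (fun i => N (i%:R * h) w) m = s] /\
  process_sigma_algebra N [set w | mkseq (fun i => N (i%:R * h) w) m = s].
Proof.
move=> [_ [mN _]] h0.
have [sm|sm] := eqVneq (size s) m; last first.
  rewrite (_ : [set w | _] = set0).
    by split; [exact: measurable0|exact: sigma_algebra0].
  by apply/seteqP; split=> // w /= ws; rewrite -ws size_mkseq eqxx in sm.
have -> : [set w | mkseq (fun i => N (i%:R * h) w) m = s] =
    \bigcap_(i in [set i | (i < m)%N]) (N (i%:R * h) @^-1` [set nth 0%N s i]).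
  apply/seteqP; split=> w /=.
    by move=> <- i /= im; rewrite nth_mkseq.
  move=> H; apply: (@eq_from_nth _ 0%N); first by rewrite size_mkseq sm.
  by move=> i; rewrite size_mkseq => im; rewrite nth_mkseq //; exact: H.
have ih0 i : 0 <= i%:R * h by rewrite mulr_ge0.
split.
  apply: bigcap_measurableType => i _; rewrite -[X in measurable X]setTI.
  by apply: mN.
pose G := \bigcup_(t in [set t : R | 0 <= t]) g_sigma_algebra_preimage (N t).
apply: (@bigcap_measurableType _ (g_sigma_algebraType G)) => i _.
apply: sub_sigma_algebra; exists (i%:R * h) => //=.
by exists [set nth 0%N s i] => //; rewrite setTI.
Qed.

Lemma poisson_increments (R : realType) (d : measure_display)
    (T : measurableType d) (P : probability T R) (rate : R -> R)
    (N : R -> T -> nat) (h : R) (m : nat) (A : nat -> set nat) :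
  is_poisson_process P rate N -> 0 <= h ->
  P [set w | forall i, (i < m)%N -> A i (N (i.+1%:R * h)%R w - N (i%:R * h)%R w)%N] =
  (\prod_(i < m) poisson_prob (cell_mean rate h i) 0%N (A i))%E.
Proof.
move=> [_ [_ [_ [_ [_ [indep law]]]]]] h0.
have tau_le i j : (i <= j)%N -> i%:R * h <= j%:R * h.
  by move=> ij; rewrite ler_wpM2r// ler_nat.
have := mutually_independent_seq (s := iota 0 m) (E := fun i =>
  [set w | A i (N (i.+1%:R * h)%R w - N (i%:R * h)%R w)%N])
  (indep (fun i => i%:R * h) _ tau_le) (iota_uniq 0 m).
have iotaE : iota 0 m = index_iota 0 m by rewrite /index_iota subn0.
rewrite [X in (\prod_(i <- X) _)%E]iotaE big_mkord mul0r lexx => /(_ isT) H.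
rewrite (eq_bigr (fun i : 'I_m =>
  P [set w | A i (N (i.+1%:R * h)%R w - N (i%:R * h)%R w)%N])); last first.
  by move=> i _; rewrite law// ?mulr_ge0// tau_le.
rewrite -H; last by move=> i _; exists (A i) => //; rewrite setTI.
congr (P _); apply/seteqP; split=> w /=.
  by move=> Aw i /=; rewrite mem_iota => /andP[_ im]; exact: Aw.
by move=> Aw i im; apply: Aw; rewrite /= mem_iota.
Qed.

(** The numbers of steps that [hit_prob] distinguishes: none, odd, and even
    positive. *)
Definition gap_class (k : nat) : 'I_3 :=
  inord (if k == 0%N then 0%N else if odd k then 1%N else 2%N).

Lemma hit_prob_gap_class (R : realType) (k : nat) :
  hit_prob R k = hit_prob R (gap_class k).
Proof.
by rewrite /gap_class inordK; case: k => // k; rewrite /hit_prob /=; case: (odd k).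
Qed.

(** Masses of these classes under the Poisson law of mean [a]. *)
Definition gap_prob (R : realType) (a : R) (z : 'I_3) : R :=
  match val z with
  | 0%N => expR (- a)
  | 1%N => (1 - expR (- (a *+ 2))) / 2
  | _ => (1 + expR (- (a *+ 2))) / 2 - expR (- a)
  end.

Lemma gap_class0 (k : nat) : (gap_class k = inord 0) <-> k = 0%N.
Proof.
split=> [|-> //] /(congr1 val); rewrite /= !inordK//; last by case: ifP => // _; case: ifP.
by case: k => // k; rewrite /=; case: ifP.
Qed.

Lemma gap_class1 (k : nat) : (gap_class k = inord 1) <-> odd k.
Proof.
split=> [|ok]; last by rewrite /gap_class ok; case: k ok.
move=> /(congr1 val); rewrite /= !inordK//; last by case: ifP => // _; case: ifP.
by case: k => // k; rewrite /=; case: ifP.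
Qed.

Lemma ord3_cases (Q : 'I_3 -> Prop) : Q (inord 0) -> Q (inord 1) ->
  Q (inord 2) -> forall z, Q z.
Proof.
move=> Q0 Q1 Q2 z; have : [\/ z = inord 0, z = inord 1 | z = inord 2].
  by case: z => [[|[|[|//]]] lt]; [apply: Or31|apply: Or32|apply: Or33];
    apply: val_inj; rewrite /= inordK.
by case=> ->.
Qed.

Lemma big_ord3 (R : Type) (idx : R) (op : Monoid.law idx) (F : 'I_3 -> R) :
  \big[op/idx]_(z < 3) F z = op (F (inord 0)) (op (F (inord 1)) (F (inord 2))).
Proof.
rewrite !big_ord_recl big_ord0 Monoid.mulm1; congr (op (F _) (op (F _) (F _)));
  by apply: val_inj; rewrite /= inordK.
Qed.

Lemma poisson_prob_gap_class (R : realType) (a : R) (z : 'I_3) : 0 <= a ->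
  poisson_prob a 0%N [set k | gap_class k = z] = (gap_prob a z)%:E.
Proof.
move=> a0.
have p0 : poisson_prob a 0%N [set k | gap_class k = inord 0] = (expR (- a))%:E.
  rewrite -(poisson_prob_zero 0%N a0); congr poisson_prob.
  by apply/seteqP; split=> k /=; rewrite gap_class0.
have p1 : poisson_prob a 0%N [set k | gap_class k = inord 1] =
    ((1 - expR (- (a *+ 2))) / 2)%:E.
  rewrite -(poisson_prob_odd 0%N a0); congr poisson_prob.
  by apply/seteqP; split=> k /=; rewrite gap_class1.
elim/ord3_cases: z; rewrite /gap_prob /= inordK//.
have [r pr] : exists r : R,
    poisson_prob a 0%N [set k | gap_class k = inord 2] = r%:E.
  exists (fine (poisson_prob a 0%N [set k | gap_class k = inord 2])).
  by rewrite fineK//; exact: (@fin_num_measure _ _ _ (poisson_prob a 0%N)).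
have [_] := @measure_finite_partition R _ nat (poisson_prob a 0%N) _ gap_class
  setT (fun _ => I).
under eq_bigr do rewrite setTI.
rewrite big_ord3 [X in _ = (X + _)%E]p0 [X in _ = (_ + (X + _))%E]p1.
rewrite [X in _ = (_ + (_ + X))%E]pr.
rewrite [X in X = _](@probability_setT _ _ _ (poisson_prob a 0%N)).
rewrite pr -!EFinD => -[e]; congr EFin; lra.
Qed.

(** * Law of the directions at the grid times *)

(** The joint law of the counts at the grid times, the initial direction and
    finitely many coins factorizes. *)
Lemma planar_cylinder (R : realType) (d : measure_display)
    (T : measurableType d) (P : probability T R) (rate : R -> R)
    (N : R -> T -> nat) (k0 : T -> 'Z_4) (xi : nat -> T -> bool)
    (h : R) (m : nat) (s : seq nat) (a : 'Z_4) (p : seq bool) :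
  is_poisson_process P rate N ->
  (forall k : 'Z_4, measurable (k0 @^-1` [set k]) /\
                    P (k0 @^-1` [set k]) = (4^-1)%:E) ->
  (forall n, is_fair_coin P (xi n)) ->
  mutually_independent P (fun i : bool + nat =>
      match i with
      | inl true => process_sigma_algebra N
      | inl false => preimage_set_system setT k0 [set: set 'Z_4]
      | inr n => g_sigma_algebra_preimage (xi n)
      end) -> 0 <= h ->
  let S := [set w | mkseq (fun i => N (i%:R * h) w) m = s] in
  let C := [set w | (S `&` k0 @^-1` [set a]) w /\
    mkseq (xi^~ w) (size p) = p] in
  measurable C /\ P C = (fine (P S) / 4 / 2 ^+ size p)%:E.
Proof.
move=> HN Hk Hxi indep h0 S C.
have [mS sS] := poisson_counts_measurable m s HN h0.
pose E (i : bool + nat) := match i with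
  | inl true => S
  | inl false => k0 @^-1` [set a]
  | inr n => xi n @^-1` [set nth false p n]
  end.
pose l : seq (bool + nat) :=
  inl true :: inl false :: [seq inr i | i <- iota 0 (size p)].
have CE : C = \bigcap_(i in [set` l]) E i.
  apply/seteqP; split=> w /=.
    move=> [[Sw kw] pw] [[]|n] //= ; rewrite !inE /= => /mapP[i].
    by rewrite mem_iota => /andP[_ ip] [->]; rewrite -pw nth_mkseq.
  move=> Ew; split; first by split; [exact: (Ew (inl true))|exact: (Ew (inl false))].
  apply: (@eq_from_nth _ false); rewrite size_mkseq // => i ip.
  rewrite nth_mkseq//; apply: (Ew (inr i)); rewrite /= !inE /=.
  by apply: map_f; rewrite mem_iota.
split.
  rewrite CE; apply: fin_bigcap_measurable => [|[[]|n] _ /=];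
    [exact: finite_seq|by []|exact: (Hk a).1|].
  by rewrite -[X in measurable X]setTI; apply: (Hxi n).1.
rewrite CE (mutually_independent_seq indep).
- rewrite !big_cons big_map /= (Hk a).2.
  rewrite (eq_bigr (fun=> (2^-1)%:E)); last by move=> n _; exact: (Hxi n).2.
  rewrite -(big_map (fun=> 2^-1) predT (fun x : R => x%:E)) prodEFin big_map.
  rewrite big_const_seq count_predT size_iota iter_mulr_1 -exprVn.
  rewrite -[P S]fineK ?fin_num_measure// -!EFinM; congr EFin; lra.
- rewrite /= !inE /= map_inj_uniq ?iota_uniq; last by move=> i j [].
  by rewrite andbT; apply/andP; split; apply/mapP => -[].
- move=> [[]|n] _ //=; last by exists [set nth false p n] => //; rewrite setTI.
  by exists [set a] => //; rewrite setTI.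
Qed.

Lemma take_mkseq (T : Type) (f : nat -> T) (k n : nat) : (k <= n)%N ->
  take k (mkseq f n) = mkseq f k.
Proof. by move=> kn; rewrite /mkseq -map_take take_iota (minn_idPl kn). Qed.

(** Given the counts at the grid times, the directions form a walk whose
    conditional law depends on the counts only through their classes.  Summing
    over the counts of given classes, then over the finitely many vectors of
    classes, leaves a product over the cells. *)
Lemma planar_direction_law (R : realType) (d : measure_display)
    (T : measurableType d) (P : probability T R) (rate : R -> R)
    (N : R -> T -> nat) (k0 : T -> 'Z_4) (xi : nat -> T -> bool)
    (h : R) (m : nat) (kappa : nat -> 'Z_4) :
  is_poisson_process P rate N ->
  (forall k : 'Z_4, measurable (k0 @^-1` [set k]) /\
                    P (k0 @^-1` [set k]) = (4^-1)%:E) ->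
  (forall n, is_fair_coin P (xi n)) ->
  mutually_independent P (fun i : bool + nat =>
      match i with
      | inl true => process_sigma_algebra N
      | inl false => preimage_set_system setT k0 [set: set 'Z_4]
      | inr n => g_sigma_algebra_preimage (xi n)
      end) -> 0 <= h -> (forall i, 0 <= cell_mean rate h i) ->
  let E := [set w | forall i, (i <= m)%N ->
    direction_index k0 xi (N (i%:R * h) w) w = kappa i] in
  measurable E /\
  P E = (4^-1 * \prod_(i < m) \sum_z
     gap_prob (cell_mean rate h i) z * hit_prob R z (kappa i) (kappa i.+1))%:E.
Proof.
move=> HN Hk Hxi indep h0 mean0 E.
pose nu w := mkseq (fun i => N (i%:R * h) w) m.+1.
have mnu s : measurable (nu @^-1` [set s]).
  exact: (poisson_counts_measurable m.+1 s HN h0).1.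
have Nle w : {homo (fun i : nat => N (i%:R * h) w) : i j / (i <= j)%N}.
  move=> i j ij; have [_ [_ [_ [Nmono _]]]] := HN.
  by apply: Nmono; rewrite ?mulr_ge0// ler_wpM2r// ler_nat.
have N0 w : N (0%:R * h) w = 0%N by rewrite mul0r; have [_ [_ []]] := HN.
(* given the counts, the walk is a function of finitely many coins *)
have atom s : measurable (E `&` nu @^-1` [set s]) /\
    P (E `&` nu @^-1` [set s]) =
    ((4^-1 * \prod_(i < m) hit_prob R (nth 0%N s i.+1 - nth 0%N s i)
        (kappa i) (kappa i.+1))%:E * P (nu @^-1` [set s]))%E.
  have [[w0 nus]|nos] := pselect (exists w, nu w = s); last first.
    rewrite (_ : nu @^-1` [set s] = set0) ?setI0 ?measure0 ?mule0; first by split.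
    by apply/seteqP; split=> // w sw; apply: nos; exists w.
  pose n i := N (i%:R * h) w0.
  have nth_s i : (i <= m)%N -> nth 0%N s i = n i.
    by move=> im; rewrite -nus nth_mkseq.
  have /(_ (n m) (walk_hits n kappa (kappa 0%N) m))[mC PC] :=
    coin_mean_event (fun p => planar_cylinder m.+1 s (kappa 0%N) p HN Hk Hxi indep h0).
  set C := (X in measurable X) in mC.
  have EC : E `&` nu @^-1` [set s] = C.
    have nuN w i : nu w = s -> (i <= m)%N -> N (i%:R * h) w = n i.
      by move=> ws im; rewrite -nth_s// -ws nth_mkseq.
    apply/seteqP; split=> w /=.
      move=> [Ew ws]; split.
        by split=> //; have := Ew 0%N (leq0n m); rewrite N0.
      apply/allP => i; rewrite mem_iota add0n ltnS => im.
      rewrite take_mkseq; last exact: Nle.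
      have := Ew i im; rewrite direction_indexE (nuN _ _ ws im) => <-.
      by have := Ew 0%N (leq0n m); rewrite N0 /= => ->.
    move=> [[ws kw] /allP hits]; split=> // i im.
    have := hits i; rewrite mem_iota add0n ltnS => /(_ im) /eqP <-.
    by rewrite take_mkseq ?Nle// direction_indexE (nuN _ _ ws im) kw.
  rewrite EC; split=> //; rewrite [LHS]PC coin_mean_walk; [|exact: N0|exact: Nle].
  rewrite eqxx mul1r -[P (nu @^-1` [set s])]fineK ?fin_num_measure// -EFinM.
  rewrite (eq_bigr (fun i : 'I_m => hit_prob R (nth 0%N s i.+1 - nth 0%N s i)
    (kappa i) (kappa i.+1))); last by move=> i _; rewrite !nth_s// ltnW.
  congr EFin; rewrite /nu /preimage /=; ring.
pose cls w : {ffun 'I_m -> 'I_3} :=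
  [ffun i : 'I_m => gap_class (N (i.+1%:R * h)%R w - N (i%:R * h)%R w)%N].
have gap (z : {ffun 'I_m -> 'I_3}) : measurable (E `&` cls @^-1` [set z]) /\
    P (E `&` cls @^-1` [set z]) = ((4^-1 * \prod_(i < m) (
      gap_prob (cell_mean rate h i) (z i) *
      hit_prob R (z i) (kappa i) (kappa i.+1)))%:E)%E.
  pose C : set (seq nat) := [set s | forall i : 'I_m,
    gap_class (nth 0%N s i.+1 - nth 0%N s i)%N = z i].
  have clsE : cls @^-1` [set z] = nu @^-1` C.
    apply/seteqP; split=> w /=.
      move=> clsw i; rewrite -clsw /cls ffunE /nu.
      by rewrite !nth_mkseq ?ltnS// ltnW.
    move=> Cw; apply/ffunP => i; rewrite ffunE -Cw /nu.
    by rewrite !nth_mkseq ?ltnS// ltnW.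
  have g0 : 0 <= 4^-1 * \prod_(i < m) hit_prob R (z i) (kappa i) (kappa i.+1).
    rewrite mulr_ge0// prodr_ge0// => i _; rewrite /hit_prob.
    by case: (val (z i)) => [|?]; rewrite ?divr_ge0.
  have [mE PE] : measurable (E `&` nu @^-1` C) /\
    P (E `&` nu @^-1` C) =
      ((4^-1 * \prod_(i < m) hit_prob R (z i) (kappa i) (kappa i.+1))%:E *
       P (nu @^-1` C))%E.
    apply: measure_countable_mixture => // s Cs; have [mA ->] := atom s.
    split=> //; congr (_%:E * _)%E; congr (_ * _); apply: eq_bigr => i _.
    by rewrite hit_prob_gap_class Cs.
  rewrite clsE; split=> //; rewrite PE -clsE.
  pose A i : set nat :=
    [set k | forall im : (i < m)%N, gap_class k = z (Ordinal im)].
  have -> : cls @^-1` [set z] = [set w | forall i, (i < m)%N ->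
      A i (N (i.+1%:R * h)%R w - N (i%:R * h)%R w)%N].
    apply/seteqP; split=> w /=.
      by move=> clsw i im im'; rewrite -clsw /cls ffunE.
    move=> H; apply/ffunP => i; rewrite ffunE (H i (ltn_ord i) (ltn_ord i)).
    by congr (z _); apply: val_inj.
  rewrite (poisson_increments m A HN h0).
  rewrite (eq_bigr (fun i : 'I_m => (gap_prob (cell_mean rate h i) (z i))%:E)).
    rewrite prodEFin -EFinM mulrC; congr EFin; rewrite big_split /=; ring.
  move=> i _; rewrite -poisson_prob_gap_class//; congr poisson_prob.
  apply/seteqP; split=> k /=; last first.
    by move=> e im; rewrite e; congr (z _); apply: val_inj.
  by move=> /(_ (ltn_ord i)) ->; congr (z _); apply: val_inj.
have [mE ->] := measure_finite_partition P (fun z => (gap z).1).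
split=> //; under eq_bigr do rewrite (gap _).2.
by rewrite sumEFin -mulr_sumr bigA_distr_bigA.
Qed.

(** * Law of the sign patterns *)

(** Probability that a Poisson variable of mean [a / 2] is odd ([flip] true) or
    even ([flip] false). *)
Definition cell_prob (R : realType) (a : R) (flip : bool) : R :=
  (1 + (-1) ^+ flip * expR (- a)) / 2.

(** The bits tell when the components of [direction] have a negative sum,
    respectively a negative difference. *)
Definition sum_bit (a : 'Z_4) : bool := (1 < a)%N.

Definition diff_bit (a : 'Z_4) : bool := (a == 1%N :> nat) || (a == 2%N :> nat).

Definition direction_of_bits (x y : bool) : 'Z_4 :=
  if x then (if y then 1 + 1 else - 1) else (if y then 1 else 0).

Lemma sum_bitK (x y : bool) : sum_bit (direction_of_bits x y) = x.
Proof. by case: x y => -[]. Qed.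

Lemma diff_bitK (x y : bool) : diff_bit (direction_of_bits x y) = y.
Proof. by case: x y => -[]. Qed.

Lemma direction_of_bitsK (a : 'Z_4) :
  direction_of_bits (sum_bit a) (diff_bit a) = a.
Proof. by elim/Z4_cases: a. Qed.

(** Thinning: the two signs flip as in two independent cells of half the
    rate. *)
Lemma hit_prob_mean (R : realType) (a : R) (b c : 'Z_4) :
  \sum_z gap_prob a z * hit_prob R z b c =
  cell_prob a (sum_bit b (+) sum_bit c) * cell_prob a (diff_bit b (+) diff_bit c).
Proof.
rewrite big_ord3 /gap_prob /hit_prob /= !inordK// /cell_prob mulr2n opprD expRD.
by elim/Z4_cases: b; elim/Z4_cases: c; rewrite /= ?expr0 ?expr1; field.
Qed.

(** Law of the signs at the times [0], [h], ..., [m h] of a telegraph process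
    of rate [rate / 2]. *)
Definition grid_weight (R : realType) (rate : R -> R) (h : R) (m : nat)
    (x : nat -> bool) : R :=
  2^-1 * \prod_(i < m) cell_prob (cell_mean rate h i) (x i (+) x i.+1).

Definition pattern_mass (R : realType) (rate : R -> R) (h : R) (m : nat)
    (G : pred {ffun 'I_m.+1 -> bool}) : R :=
  \sum_(x | G x) grid_weight rate h m (fun i => x (inord i)).

Definition pattern (m : nat) (x : nat -> bool) : {ffun 'I_m.+1 -> bool} :=
  [ffun i : 'I_m.+1 => x i].

Lemma pattern_eq (m : nat) (x : nat -> bool) (p : {ffun 'I_m.+1 -> bool}) :
  pattern m x = p <-> forall i, (i <= m)%N -> x i = p (inord i).
Proof.
split=> [<- i im|xp]; first by rewrite ffunE inordK.
by apply/ffunP => i; rewrite ffunE xp ?inord_val// -ltnS.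
Qed.

(** [hit_prob_mean] has a product form cell by cell, which makes the two sign
    patterns independent. *)
Lemma planar_pattern_law (R : realType) (d : measure_display)
    (T : measurableType d) (P : probability T R) (rate : R -> R)
    (N : R -> T -> nat) (k0 : T -> 'Z_4) (xi : nat -> T -> bool)
    (h : R) (m : nat) (G H : pred {ffun 'I_m.+1 -> bool}) :
  is_poisson_process P rate N ->
  (forall k : 'Z_4, measurable (k0 @^-1` [set k]) /\
                    P (k0 @^-1` [set k]) = (4^-1)%:E) ->
  (forall n, is_fair_coin P (xi n)) ->
  mutually_independent P (fun i : bool + nat =>
      match i with
      | inl true => process_sigma_algebra N
      | inl false => preimage_set_system setT k0 [set: set 'Z_4]
      | inr n => g_sigma_algebra_preimage (xi n)
      end) -> 0 <= h -> (forall i, 0 <= cell_mean rate h i) ->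
  let D i w := direction_index k0 xi (N (i%:R * h) w) w in
  let E := [set w | G (pattern m (fun i => sum_bit (D i w))) &&
                    H (pattern m (fun i => diff_bit (D i w)))] in
  measurable E /\
  P E = (pattern_mass rate h G * pattern_mass rate h H)%:E.
Proof.
move=> HN Hk Hxi indep h0 mean0 D E.
pose nu w := (pattern m (fun i => sum_bit (D i w)),
              pattern m (fun i => diff_bit (D i w))).
have law z : measurable (nu @^-1` [set z]) /\ P (nu @^-1` [set z]) =
  (grid_weight rate h m (fun i => z.1 (inord i)) *
   grid_weight rate h m (fun i => z.2 (inord i)))%:E.
  have [mA PA] := planar_direction_law m
    (fun i => direction_of_bits (z.1 (inord i)) (z.2 (inord i)))
    HN Hk Hxi indep h0 mean0.
  have -> : nu @^-1` [set z] = [set w | forall i, (i <= m)%N ->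
      direction_index k0 xi (N (i%:R * h) w) w =
      direction_of_bits (z.1 (inord i)) (z.2 (inord i))].
    apply/seteqP; split=> w /=; last first.
      move=> Aw; rewrite (surjective_pairing z); congr (_, _);
        by apply/pattern_eq => i im; rewrite /D Aw// ?sum_bitK ?diff_bitK.
    case: (z) => p q [] /pattern_eq pw /pattern_eq qw i im.
    by rewrite -pw// -qw// direction_of_bitsK.
  split=> //; rewrite [LHS]PA; congr EFin; rewrite /grid_weight.
  rewrite mulrACA -big_split /=; congr (_ * _); first by field.
  by apply: eq_bigr => i _; rewrite hit_prob_mean !sum_bitK !diff_bitK.
have part z : E `&` nu @^-1` [set z] =
    if G z.1 && H z.2 then nu @^-1` [set z] else set0.
  case: ifPn => GH; apply/seteqP; split=> w //=.
  - by move=> [].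
  - by move=> nuw; split=> //; move: GH; rewrite -nuw.
  - by move=> [Ew nuw]; move: GH; rewrite -nuw /= Ew.
have mpart z : measurable (E `&` nu @^-1` [set z]).
  by rewrite part; case: ifP => // _; exact: (law z).1.
have [mE ->] := measure_finite_partition P mpart.
split=> //.
transitivity (\sum_(z : {ffun 'I_m.+1 -> bool} * {ffun 'I_m.+1 -> bool})
    (if G z.1 && H z.2 then grid_weight rate h m (fun i => z.1 (inord i)) *
      grid_weight rate h m (fun i => z.2 (inord i)) else 0)%:E)%E.
  apply: eq_bigr => z _; rewrite part; case: ifP => _; last exact: measure0.
  exact: (law z).2.
rewrite sumEFin -big_mkcond /= big_distrlr /= pair_big; congr EFin.
Qed.

(** The sign flips in a cell when the number of events is odd, and at half the
    rate that has probability [cell_prob]. *)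
Lemma telegraph_pattern_law (R : realType) (d : measure_display)
    (T : measurableType d) (P : probability T R) (rate : R -> R)
    (N : R -> T -> nat) (e : T -> bool)
    (h : R) (m : nat) (G : pred {ffun 'I_m.+1 -> bool}) :
  is_poisson_process P (fun t => rate t / 2) N ->
  is_fair_coin P e ->
  mutually_independent P (fun b : bool =>
      if b then g_sigma_algebra_preimage e else process_sigma_algebra N) ->
  0 <= h ->
  (forall i, 0 <= cell_mean rate h i) ->
  (forall i, cell_mean rate h i = cell_mean (fun t => rate t / 2) h i *+ 2) ->
  let E := [set w | G (pattern m (fun i => odd (e w + N (i%:R * h)%R w)))] in
  measurable E /\ P E = (pattern_mass rate h G)%:E.
Proof.
move=> HN He indep h0 mean0 mean2 E.
pose nu w := pattern m (fun i => odd (e w + N (i%:R * h)%R w)).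
pose cnt w := mkseq (fun i => N (i%:R * h) w) m.+1.
have N0 w : N (0%:R * h) w = 0%N by rewrite mul0r; have [_ [_ []]] := HN.
have Nle w i : (N (i%:R * h)%R w <= N (i.+1%:R * h)%R w)%N.
  have [_ [_ [_ [Nmono _]]]] := HN.
  by apply: Nmono; rewrite ?mulr_ge0// ler_wpM2r// ler_nat.
have law z : measurable (nu @^-1` [set z]) /\ P (nu @^-1` [set z]) =
    (grid_weight rate h m (fun i => z (inord i)))%:E.
  pose x i := z (inord i).
  pose C : set (seq nat) := [set s | forall i, (i < m)%N ->
    odd (nth 0%N s i.+1 - nth 0%N s i) = x i (+) x i.+1].
  have -> : nu @^-1` [set z] = (e @^-1` [set x 0%N]) `&` cnt @^-1` C.
    apply/seteqP; split=> w /=.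
      move=> /pattern_eq zw; split.
        by rewrite -[RHS]zw// N0 addn0; case: (e w).
      move=> i im; rewrite /cnt !nth_mkseq ?ltnS//; last exact: ltnW.
      rewrite /x -!zw//; last exact: ltnW.
      by rewrite oddB ?Nle// !oddD addbACA addbb addFb addbC.
    move=> [ew Cw]; apply/pattern_eq; elim=> [|i IH] im.
      by rewrite N0 addn0 oddb.
    have := Cw i im; rewrite /cnt !nth_mkseq ?ltnS//; last exact: ltnW.
    rewrite oddB ?Nle// /x -IH; last exact: ltnW.
    rewrite !oddD; move: (odd (N (i.+1%:R * h) w)) (odd (N (i%:R * h) w)).
    by move: (odd (e w)) (z (inord i.+1)) => [] [] [] [].
  have [mE PE] : measurable (e @^-1` [set x 0%N] `&` cnt @^-1` C) /\
     P (e @^-1` [set x 0%N] `&` cnt @^-1` C) =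
      ((2^-1)%:E * P (cnt @^-1` C))%E.
    apply: measure_countable_mixture => // s.
      exact: (poisson_counts_measurable m.+1 s HN h0).1.
    move=> _; have [mS sS] := poisson_counts_measurable m.+1 s HN h0.
    have me : measurable (e @^-1` [set x 0%N]).
      by rewrite -[X in measurable X]setTI; apply: He.1.
    split; first exact: measurableI.
    pose F (b : bool) := if b then e @^-1` [set x 0%N] else cnt @^-1` [set s].
    have := mutually_independent_seq (s := [:: true; false]) (E := F) indep isT.
    rewrite !big_cons big_nil /= mule1 He.2 => <-.
      congr (P _); apply/seteqP; split=> w /=; first by move=> [? ?] [].
      by move=> H; split; [exact: (H true)|exact: (H false)].
    by case=> // _; exists [set x 0%N] => //; rewrite setTI.
  split=> //; rewrite PE /grid_weight EFinM -prodEFin; congr (_ * _)%E.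
  pose A i : set nat := [set k | odd k = x i (+) x i.+1].
  have -> : cnt @^-1` C = [set w | forall i, (i < m)%N ->
      A i (N (i.+1%:R * h)%R w - N (i%:R * h)%R w)%N].
    apply/seteqP; split=> w /= H i im; have := H i im;
      by rewrite /cnt !nth_mkseq ?ltnS// ltnW.
  rewrite (poisson_increments m A HN h0); apply: eq_bigr => i _.
  have mean0' : 0 <= cell_mean (fun t => rate t / 2) h i.
    by have := mean0 i; rewrite mean2; lra.
  rewrite /A -/(x i) -/(x i.+1); case: (x i (+) x i.+1).
    by rewrite poisson_prob_odd// -mean2 /cell_prob expr1 mulN1r.
  rewrite [X in poisson_prob _ _ X](_ : _ = ~` [set k | odd k]); last first.
    by apply/seteqP; split=> k /=; case: (odd k).
  rewrite (@probability_setC _ _ _ (poisson_prob _ 0%N))//.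
  rewrite [X in (_ - X)%E]poisson_prob_odd// -mean2 -EFinB; congr EFin.
  rewrite /cell_prob expr0; lra.
have part z : E `&` nu @^-1` [set z] =
    if G z then nu @^-1` [set z] else set0.
  case: ifPn => Gz; apply/seteqP; split=> w //=.
  - by move=> [].
  - by move=> nuw; split=> //; move: Gz; rewrite -nuw.
  - by move=> [Ew nuw]; move: Gz; rewrite -nuw /= Ew.
have mpart z : measurable (E `&` nu @^-1` [set z]).
  by rewrite part; case: ifP => // _; exact: (law z).1.
have [mE ->] := measure_finite_partition P mpart.
split=> //; rewrite /pattern_mass [in RHS]big_mkcond -sumEFin.
apply: eq_bigr => z _; rewrite part; case: ifP => _; last exact: measure0.
exact: (law z).2.
Qed.

(** * Riemann sums of counting paths *)

Lemma counting_path_integrable (R : realType) (N : R -> nat) (g : nat -> R)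
    (v t : R) :
  (forall s u, 0 <= s -> s <= u -> (N s <= N u)%N) ->
  (forall k, `|g k| <= v) ->
  lebesgue_measure.-integrable `[0, t] (EFin \o (g \o N)).
Proof.
move=> Nmono gv; apply: measurable_bounded_integrable => //.
- rewrite /= lebesgue_measure_itv /=; case: ifP => // _.
  by rewrite -EFinB ltry.
- have mN : measurable_fun `[0, t] (fun s => (N (Num.max 0 s))%:R : R).
    apply: nondecreasing_measurable => // s u su; rewrite ler_nat.
    apply: Nmono; first by rewrite le_max lexx.
    by rewrite ge_max !le_max lexx su orbT.
  move=> _ B mB; rewrite (_ : _ `&` _ = \bigcup_(k in [set k | B (g k)])
      (`[0, t] `&` (fun s => (N (Num.max 0 s))%:R : R) @^-1` [set k%:R])).
    by apply: bigcup_measurable => k _; exact: mN.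
  apply/seteqP; split=> s /=.
    rewrite in_itv /= => -[/andP[s0 st] Bs]; exists (N s) => //=.
    by rewrite in_itv /= s0 st max_r.
  move=> [k Bk [/=]]; rewrite in_itv /= => /andP[s0 st]; rewrite max_r//.
  move=> /eqP; rewrite eqr_nat => /eqP Ns.
  by split; [rewrite s0 st|rewrite Ns].
- by exists v; split=> [|r vr x _] /=; [exact: num_real|rewrite (le_trans (gv _))// ltW].
Qed.

Lemma counting_path_lipschitz (R : realType) (N : R -> nat) (g : nat -> R)
    (v s t : R) :
  (forall s u, 0 <= s -> s <= u -> (N s <= N u)%N) ->
  (forall k, `|g k| <= v) -> 0 <= s -> s <= t ->
  `|\int[lebesgue_measure]_(u in `[0, t]) g (N u) -
    \int[lebesgue_measure]_(u in `[0, s]) g (N u)| <= v * (t - s).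
Proof.
move=> Nmono gv s0 st.
have int_t := counting_path_integrable t Nmono gv.
rewrite Rintegral_itvB ?bnd_simp//.
have int_st : lebesgue_measure.-integrable `]s, t] (EFin \o (g \o N)).
  by apply: integrableS int_t => //; apply: subset_itvr; rewrite bnd_simp.
apply: (le_trans (le_normr_Rintegral _ int_st)) => //.
have <- : \int[lebesgue_measure]_(u in `]s, t]) v = v * (t - s).
  rewrite Rintegral_cst//= lebesgue_measure_itv /= lte_fin.
  case: ltP => [//|ts]; rewrite [t](_ : _ = s) ?subrr//.
  by apply/eqP; rewrite eq_le ts st.
apply: le_Rintegral => //.
- exact: integrable_norm int_st.
- apply: measurable_bounded_integrable => //.
    rewrite /= lebesgue_measure_itv /=; case: ifP => // _.
    by rewrite -EFinB ltry.
  by exists `|v|; split=> [|r vr x _] //=; rewrite ltW.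
- by move=> u _; exact: gv.
Qed.

(** On a cell without event the velocity is constant, and every other cell
    contains at least one event. *)
Lemma counting_path_cell (R : realType) (N : R -> nat) (g : nat -> R)
    (v s t : R) :
  (forall s u, 0 <= s -> s <= u -> (N s <= N u)%N) ->
  (forall k, `|g k| <= v) -> 0 <= s -> s <= t ->
  `|\int[lebesgue_measure]_(u in `[0, t]) g (N u) -
    \int[lebesgue_measure]_(u in `[0, s]) g (N u) - (t - s) * g (N s)|
  <= 2 * v * (t - s) * ((N t)%:R - (N s)%:R).
Proof.
move=> Nmono gv s0 st.
have [Nst|Nst] := eqVneq (N s) (N t).
  rewrite Rintegral_itvB ?bnd_simp//; last exact: counting_path_integrable t Nmono gv.
  rewrite (@eq_Rintegral _ _ _ _ _ (fun=> g (N s))); last first.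
    move=> u; rewrite inE /= in_itv /= => /andP[su ut]; congr g; apply/eqP.
    rewrite eqn_leq (Nmono s u) ?(ltW su)// Nst andbT.
    by apply: Nmono => //; exact/ltW/(le_lt_trans s0 su).
  rewrite Rintegral_cst//= lebesgue_measure_itv /= lte_fin.
  case: ltP => [_|ts] /=; first by rewrite mulrC subrr normr0 Nst subrr mulr0.
  have -> : t = s by apply/eqP; rewrite eq_le ts st.
  by rewrite subrr mul0r mulr0 !subr0 normr0 mulr0 mul0r.
have lip := counting_path_lipschitz Nmono gv s0 st.
apply: (le_trans (ler_normB _ _)).
have v0 : 0 <= v by apply: le_trans (gv 0%N).
have ts0 : 0 <= t - s by rewrite subr_ge0.
have gs : `|(t - s) * g (N s)| <= v * (t - s).
  by rewrite normrM ger0_norm// mulrC ler_wpM2r.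
have N1 : 1 <= (N t)%:R - (N s)%:R :> R.
  rewrite lerBrDr -[X in X + _]/(1%:R) -natrD ler_nat add1n.
  by rewrite ltn_neqAle Nst Nmono.
apply: (le_trans (lerD lip gs)).
have -> : v * (t - s) + v * (t - s) = 2 * v * (t - s) * 1 by ring.
by rewrite ler_wpM2l// mulr_ge0// mulr_ge0.
Qed.

(** The errors of [counting_path_cell] over the cells telescope to the number
    of events. *)
Lemma counting_path_riemann (R : realType) (N : R -> nat) (g : nat -> R)
    (v h : R) (j : nat) :
  (forall s u, 0 <= s -> s <= u -> (N s <= N u)%N) ->
  (forall k, `|g k| <= v) -> 0 <= h ->
  `|\int[lebesgue_measure]_(u in `[0, j%:R * h]) g (N u) -
    h * \sum_(i < j) g (N (i%:R * h))| <= 2 * v * h * (N (j%:R * h))%:R.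
Proof.
move=> Nmono gv h0.
have v0 : 0 <= v by apply: le_trans (gv 0%N).
elim: j => [|j IH].
  rewrite mul0r big_ord0 mulr0 subr0 set_itv1 Rintegral_set1 normr0.
  by rewrite !mulr_ge0.
have jh0 : 0 <= j%:R * h by rewrite mulr_ge0.
have jS : j%:R * h <= j.+1%:R * h by rewrite ler_wpM2r// ler_nat.
have := counting_path_cell Nmono gv jh0 jS.
have -> : j.+1%:R * h - j%:R * h = h by rewrite -natr1; ring.
move=> cell; rewrite big_ord_recr /= mulrDr.
set A := \int[_]_(_ in _) _ in cell *; set B := \int[_]_(_ in _) _ in IH cell.
set S := h * \sum_(i < j) _ in IH *.
rewrite (_ : A - _ = (A - B - h * g (N (j%:R * h))) + (B - S)); last by ring.
apply: (le_trans (ler_normD _ _)); apply: (le_trans (lerD cell IH)).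
by rewrite -mulrDr subrK.
Qed.

(** * Limits of distribution functions *)

Lemma fine_probability_le (R : realType) (d : measure_display)
    (T : measurableType d) (P : probability T R) (A B : set T) :
  measurable A -> measurable B -> A `<=` B -> fine (P A) <= fine (P B).
Proof.
move=> mA mB AB; apply: fine_le; rewrite ?fin_num_measure//.
by apply: le_measure; rewrite ?inE.
Qed.

Lemma fine_probability_setC (R : realType) (d : measure_display)
    (T : measurableType d) (P : probability T R) (A : set T) :
  measurable A -> fine (P (~` A)) = 1 - fine (P A).
Proof.
by move=> mA; rewrite probability_setC// fineB ?fin_num_measure.
Qed.

(** The tail intersections of [F] increase to an event that contains [A]. *)
Lemma probability_le_liminf (R : realType) (d : measure_display)
    (T : measurableType d) (P : probability T R) (A : set T)
    (F : nat -> set T) (eta : R) :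
  measurable A -> (forall n, measurable (F n)) ->
  (forall w, A w -> \forall n \near \oo, F n w) -> 0 < eta ->
  \forall n \near \oo, fine (P A) - eta <= fine (P (F n)).
Proof.
move=> mA mF AF eta0.
pose B m := \bigcap_(n in [set n | (m <= n)%N]) F n.
have mB m : measurable (B m) by apply: bigcap_measurableType => n _.
have mUB : measurable (\bigcup_m B m) by apply: bigcup_measurable => m _.
have AB : A `<=` \bigcup_m B m.
  by move=> w /AF [m _ Fw]; exists m => // n mn; exact: Fw.
have cvB : P (B m) @[m --> \oo] --> P (\bigcup_m B m).
  apply: nondecreasing_cvg_mu => // m n mn; apply/subsetPset => w Bw k nk.
  by apply: Bw; rewrite /= (leq_trans mn).
have cvfB : fine (P (B m)) @[m --> \oo] --> fine (P (\bigcup_m B m)).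
  by apply: fine_cvg; rewrite fineK// fin_num_measure.
have : \forall m \near \oo, `|fine (P (\bigcup_m B m)) - fine (P (B m))| < eta.
  by move/cvgrPdist_lt : cvfB => /(_ _ eta0).
move=> [m _ /(_ m (leqnn m))] /=; rewrite ltr_norml => /andP[_ lt_eta].
have le1 := fine_probability_le P mA mUB AB.
exists m => // n /= mn.
have le2 : fine (P (B m)) <= fine (P (F n)).
  by apply: fine_probability_le => // w; apply.
lra.
Qed.

Lemma probability_ge_limsup (R : realType) (d : measure_display)
    (T : measurableType d) (P : probability T R) (A : set T)
    (F : nat -> set T) (eta : R) :
  measurable A -> (forall n, measurable (F n)) ->
  (forall w, ~ A w -> \forall n \near \oo, ~ F n w) -> 0 < eta ->
  \forall n \near \oo, fine (P (F n)) <= fine (P A) + eta.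
Proof.
move=> mA mF AF eta0.
have := @probability_le_liminf R d T P (~` A) (fun n => ~` F n) eta
  (measurableC mA) (fun n => measurableC (mF n)) AF eta0.
apply: filterS => n; rewrite !fine_probability_setC//; lra.
Qed.

Lemma measurable_fun_le_level (R : realType) (d : measure_display)
    (T : measurableType d) (X : T -> R) :
  (forall x, measurable [set w | X w <= x]) -> measurable_fun setT X.
Proof.
move=> mX _; apply: (measurability _ (RGenOInfty.measurableE R)) => //.
move=> _ [_ [x ->] <-]; rewrite setTI (_ : _ @^-1` _ = ~` [set w | X w <= x]).
  exact: measurableC.
by apply/seteqP; split=> w /=; rewrite in_itv /= andbT ltNge => /negP.
Qed.

Lemma measurable_le_level (R : realType) (d : measure_display)
    (T : measurableType d) (X : T -> R) :
  measurable_fun setT X -> forall x, measurable [set w | X w <= x].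
Proof.
move=> mX x; rewrite [X in measurable X](_ : _ = setT `&` X @^-1` `]-oo, x]).
  by apply: mX.
by apply/seteqP; split=> w /=; rewrite in_itv /= => // -[].
Qed.

(** For [e > 0], the event [X <= b] lies in the liminf of the events
    [X_n <= b + e], whose limsup lies in [X <= b + e]; distribution functions
    are right continuous. *)
Lemma distribution_limit (R : realType) (d : measure_display)
    (T : measurableType d) (P : probability T R) (Xn : nat -> T -> R)
    (X : T -> R) (b eta : R) :
  (forall n, measurable_fun setT (Xn n)) ->
  (forall w, Xn n w @[n --> \oo] --> X w) -> 0 < eta ->
  exists2 e0 : R, 0 < e0 & forall e, 0 < e <= e0 ->
  \forall n \near \oo,
    `|fine (P [set w | Xn n w <= b + e]) - fine (P [set w | X w <= b])| <= eta.
Proof.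
move=> mXn cvX eta0.
have mX : measurable_fun setT X by apply: measurable_fun_cvg mXn _ => w _.
have mlX := measurable_le_level mX.
have mlXn n := measurable_le_level (mXn n).
have eta2 : 0 < eta / 2 by rewrite divr_gt0.
have [k _ /(_ k (leqnn k)) /= Pk] : \forall k \near \oo,
    fine (P [set w | X w <= b + k.+1%:R^-1]) <=
    fine (P [set w | X w <= b]) + eta / 2.
  apply: (@probability_ge_limsup _ _ _ _ _ (fun k => [set w | X w <= b + k.+1%:R^-1])) => //.
  move=> w /negP; rewrite -ltNge => bX.
  have : 0 < X w - b by rewrite subr_gt0.
  move=> bX0; have := near_infty_natSinv_lt (PosNum bX0); apply: filterS => n lt_n; apply/negP.
  by rewrite -ltNge -ltrBrDl.
exists k.+1%:R^-1 => // e /andP[e0 ek].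
have near_w w : \forall n \near \oo, `|X w - Xn n w| < e / 2.
  by have /cvgrPdist_lt := cvX w; apply; rewrite divr_gt0.
have Pe : fine (P [set w | X w <= b + e]) <= fine (P [set w | X w <= b + k.+1%:R^-1]).
  by apply: fine_probability_le => // w /= /le_trans; apply; rewrite lerD2l.
have lo : \forall n \near \oo,
    fine (P [set w | X w <= b]) - eta <= fine (P [set w | Xn n w <= b + e]).
  apply: (@probability_le_liminf _ _ _ _ _ (fun n => [set w | Xn n w <= b + e])) => //.
  move=> w /= Xb; apply: filterS (near_w w) => n.
  rewrite ltr_norml => /andP[]; lra.
have hi : \forall n \near \oo,
    fine (P [set w | Xn n w <= b + e]) <= fine (P [set w | X w <= b + e]) + eta / 2.
  apply: (@probability_ge_limsup _ _ _ _ _ (fun n => [set w | Xn n w <= b + e])) => //.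
  move=> w /= /negP; rewrite -ltNge => Xb.
  have Xbe : 0 < X w - (b + e) by rewrite subr_gt0.
  have /cvgrPdist_lt /(_ _ Xbe) := cvX w; apply: filterS => n.
  by rewrite ltr_norml => /andP[_ lt_n]; apply/negP; rewrite -ltNge; lra.
apply: filterS2 lo hi => n lo hi.
by rewrite ler_norml; apply/andP; split; lra.
Qed.

(** The approximation of [distribution_limit] holds for every small shift [e],
    so that a common one serves the two sequences. *)
Lemma distribution_limit_transfer (R : realType)
    (d : measure_display) (T : measurableType d) (P : probability T R)
    (d' : measure_display) (T' : measurableType d') (Q : probability T' R)
    (Xn : nat -> T -> R) (X : T -> R) (Yn : nat -> T' -> R) (Y : T' -> R)
    (phi : R -> R) (b : R) :
  continuous phi ->
  (forall n, measurable_fun setT (Xn n)) ->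
  (forall w, Xn n w @[n --> \oo] --> X w) ->
  (forall n, measurable_fun setT (Yn n)) ->
  (forall w, Yn n w @[n --> \oo] --> Y w) ->
  (forall n x, fine (P [set w | Xn n w <= x]) =
               phi (fine (Q [set w | Yn n w <= x]))) ->
  fine (P [set w | X w <= b]) = phi (fine (Q [set w | Y w <= b])).
Proof.
move=> phi_c mXn cvX mYn cvY law; set p := fine (P _); set q := fine (Q _).
apply/eqP; rewrite -subr_eq0 -normr_le0; apply/ler_addgt0Pl => eta eta0.
have eta2 : 0 < eta / 2 by rewrite divr_gt0.
have /cvgrPdist_le /(_ _ eta2) /nbhs_ballP [dl /= dl0 phi_near] := phi_c q.
have dl2 : 0 < dl / 2 by rewrite divr_gt0.
have [e1 e10 H1] := distribution_limit P b mXn cvX eta2.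
have [e2 e20 H2] := distribution_limit Q b mYn cvY dl2.
pose e := Num.min e1 e2.
have e0 : 0 < e by rewrite lt_min e10.
have /H1 N1 : 0 < e <= e1 by rewrite e0 ge_min lexx.
have /H2 N2 : 0 < e <= e2 by rewrite e0 ge_min lexx orbT.
near \oo => n.
have : `|fine (P [set w | Xn n w <= b + e]) - p| <= eta / 2 by near: n.
have : `|fine (Q [set w | Yn n w <= b + e]) - q| <= dl / 2 by near: n.
rewrite law; set qn := fine _ => A2 A1.
have A3 : `|phi q - phi qn| <= eta / 2.
  by apply: phi_near; rewrite /ball /= distrC (le_lt_trans A2)// ltr_pdivrMr// ltr_pMr// ltr1n.
rewrite addr0 -[p - _](subrK (phi qn)).
move: A1 A3; rewrite !ler_norml => /andP[? ?] /andP[? ?].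
by apply/andP; split; lra.
Unshelve. all: by end_near. Qed.

(** * Approximation by sign patterns *)

Lemma cell_mean_ge0 (R : realType) (rate : R -> R) (h : R) (i : nat) :
  (forall t : R, 0 < t -> 0 <= rate t) ->
  (forall t : R, 0 <= t ->
     lebesgue_measure.-integrable `[0, t] (fun s => (rate s)%:E)) ->
  0 <= h -> 0 <= cell_mean rate h i.
Proof.
move=> rate0 rate_int h0; rewrite /cell_mean -Rintegral_itv_obnd_cbnd.
  apply: Rintegral_ge0 => u; rewrite /= in_itv /= => /andP[iu _].
  by apply: rate0; rewrite (le_lt_trans _ iu)// mulr_ge0.
apply: integrableS (rate_int (i.+1%:R * h) _) => //; last by rewrite mulr_ge0.
by apply: subset_itv; rewrite bnd_simp// mulr_ge0.
Qed.

Lemma cell_mean_half (R : realType) (rate : R -> R) (h : R) (i : nat) :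
  (forall t : R, 0 <= t ->
     lebesgue_measure.-integrable `[0, t] (fun s => (rate s / 2)%:E)) ->
  0 <= h ->
  cell_mean rate h i = cell_mean (fun t => rate t / 2) h i *+ 2.
Proof.
move=> rate_int h0; rewrite /cell_mean -[RHS]mulr_natr.
have half_int : lebesgue_measure.-integrable `[i%:R * h, i.+1%:R * h]
    (EFin \o (fun s => rate s / 2)).
  apply: integrableS (rate_int (i.+1%:R * h) _) => //; last by rewrite mulr_ge0.
  by apply: subset_itv; rewrite bnd_simp// mulr_ge0.
rewrite -(@RintegralZr _ _ _ lebesgue_measure _ _ 2 _ half_int)//.
by apply: eq_Rintegral => u _; rewrite divfK.
Qed.

Lemma integrable_half (R : realType) (rate : R -> R) (t : R) :
  lebesgue_measure.-integrable `[0, t] (fun s => (rate s / 2)%:E) ->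
  lebesgue_measure.-integrable `[0, t] (fun s => (rate s)%:E).
Proof.
move=> rate_int.
rewrite (_ : (fun s => _) = (fun s => 2%:E * (rate s / 2)%:E)%E).
  exact: integrableZl.
by apply/funext => s; rewrite -EFinM mulrC divfK.
Qed.

Lemma cvg_mesh (R : realType) (t : R) : t / n.+1%:R @[n --> \oo] --> 0.
Proof.
rewrite -[X in _ --> X](mulr0 t); apply: cvgM; first exact: cvg_cst.
exact: cvg_harmonic.
Qed.

Lemma cvg_of_mesh_bound (R : realType) (a : nat -> R) (l C t : R) :
  (forall n, `|l - a n| <= C * (t / n.+1%:R)) -> a n @[n --> \oo] --> l.
Proof.
move=> aC; apply/cvgrPdist_le => e e0.
have : C * (t / n.+1%:R) @[n --> \oo] --> 0.
  by rewrite -[X in _ --> X](mulr0 C); apply: cvgM; [exact: cvg_cst|exact: cvg_mesh].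
move=> /cvgrPdist_le /(_ _ e0); apply: filterS => n.
rewrite sub0r normrN => Ce; apply: (le_trans (aC n)); apply: le_trans Ce.
exact: ler_norm.
Qed.

(** Between grid points [f] varies by at most [L h], and at grid points it is
    [C h]-close to [a n]. *)
Lemma running_max_limit (R : realType) (f : R -> R) (t L C : R)
    (a : nat -> nat -> R) :
  0 <= t -> 0 <= L -> 0 <= C -> (forall s, 0 <= f s) ->
  (forall s u, 0 <= s -> s <= u -> u <= t -> `|f u - f s| <= L * (u - s)) ->
  (forall n j, (j <= n.+1)%N ->
    `|f (j%:R * (t / n.+1%:R)) - a n j| <= C * (t / n.+1%:R)) ->
  \big[Num.max/0]_(j < n.+2) a n j @[n --> \oo] --> sup [set f s | s in `[0, t]].
Proof.
move=> t0 L0 C0 f0 lip fa; apply: (@cvg_of_mesh_bound _ _ _ (C + L) t) => n.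
set h := t / n.+1%:R.
have h0 : 0 <= h by rewrite divr_ge0.
have nh : n.+1%:R * h = t by rewrite mulrC divfK.
set M := sup _.
have in0 : [set f s | s in `[0, t]] (f 0).
  by exists 0 => //=; rewrite in_itv /= lexx.
have ubM : has_sup [set f s | s in `[0, t]].
  split; first by exists (f 0).
  exists (f 0 + L * t) => _ [s + <-]; rewrite /= in_itv /= => /andP[s0 st].
  have := lip 0 s (lexx 0) s0 st; rewrite subr0 ler_norml => /andP[_].
  have : L * s <= L * t by rewrite ler_wpM2l.
  lra.
have leM s : 0 <= s -> s <= t -> f s <= M.
  move=> s0 st; apply: ub_le_sup; first exact: ubM.2.
  by exists s => //=; rewrite in_itv /= s0.
have jh0 j : 0 <= j%:R * h by rewrite mulr_ge0.
have jht j : (j <= n.+1)%N -> j%:R * h <= t.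
  by move=> jn; rewrite -nh ler_wpM2r// ler_nat.
have Ch0 : 0 <= C * h by rewrite mulr_ge0.
have Lh0 : 0 <= L * h by rewrite mulr_ge0.
rewrite ler_norml; apply/andP; split.
  have : \big[Num.max/0]_(j < n.+2) a n j <= M + C * h.
    apply/bigmax_leP; split.
      by rewrite addr_ge0// (le_trans (f0 0))// leM.
    move=> j _; have := fa n j (leq_ord j); rewrite ler_norml => /andP[+ _].
    by have := leM _ (jh0 j) (jht j (leq_ord j)); rewrite -/h; lra.
  lra.
suff : M <= \big[Num.max/0]_(j < n.+2) a n j + (C + L) * h by lra.
apply: ge_sup; first by exists (f 0).
move=> _ [s + <-]; rewrite /= in_itv /= => /andP[s0 st].
have [j jn [js sj]] : exists2 j, (j <= n.+1)%N & j%:R * h <= s /\ s - j%:R * h <= h.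
  have [h00|h00] := eqVneq h 0.
    exists 0%N => //; rewrite mul0r subr0; split=> //.
    by rewrite h00; move: st; rewrite -nh h00 mulr0.
  have hpos : 0 < h by rewrite lt_def h00.
  have sh0 : 0 <= s / h by rewrite divr_ge0.
  have /andP[j1 j2] := truncn_itv sh0.
  have j1' : (Num.truncn (s / h))%:R * h <= s by rewrite -ler_pdivlMr.
  exists (Num.truncn (s / h)).
    by rewrite -(ler_nat R) -(ler_pM2r hpos) nh (le_trans j1').
  split=> //; move: j2; rewrite ltr_pdivrMr// -natr1; lra.
have aj : a n j <= \big[Num.max/0]_(j < n.+2) a n j.
  by have := le_bigmax 0 (fun j : 'I_n.+2 => a n j) (Ordinal (jn : (j < n.+2)%N)).
have := fa n j jn; rewrite ler_norml -/h => /andP[_ ?].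
have := lip _ _ (jh0 j) js st; rewrite ler_norml => /andP[_ ?].
have : L * (s - j%:R * h) <= L * h by rewrite ler_wpM2l.
lra.
Qed.

Definition bit_walk (R : realType) (v h : R) (x : nat -> bool) (j : nat) : R :=
  h * \sum_(i < j) v * (-1) ^+ x i.

Definition pattern_walk (R : realType) (v h : R) (m : nat)
    (p : {ffun 'I_m.+1 -> bool}) (j : nat) : R :=
  bit_walk v h (fun i => p (inord i)) j.

Lemma pattern_walkE (R : realType) (v h : R) (m : nat) (x : nat -> bool) (j : nat) :
  (j <= m)%N -> pattern_walk v h (pattern m x) j = bit_walk v h x j.
Proof.
move=> jm; congr (_ * _); apply: eq_bigr => i _; rewrite ffunE inordK//.
by rewrite ltnS ltnW// (leq_trans (ltn_ord i)).
Qed.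

(** The signs at the grid times determine the Riemann sums of the velocity.
    The patterns serve the value at [t] and the running maximum together. *)
Lemma telegraph_approx (R : realType) (d : measure_display)
    (T : measurableType d) (P : probability T R) (v : R) (rate : R -> R)
    (U : R -> T -> R) (t : R) :
  0 <= v -> (forall t : R, 0 < t -> 0 <= rate t) ->
  is_telegraph_process P v (fun s => rate s / 2) U -> 0 <= t ->
  exists pat : forall n : nat, T -> {ffun 'I_n.+2 -> bool},
  [/\ forall n (G : pred {ffun 'I_n.+2 -> bool}),
        measurable [set w | G (pat n w)] /\
        P [set w | G (pat n w)] = (pattern_mass rate (t / n.+1%:R) G)%:E,
      forall w, pattern_walk v (t / n.+1%:R) (pat n w) n.+1 @[n --> \oo] --> U t w
    & forall w, \big[Num.max/0]_(j < n.+2)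
        `|pattern_walk v (t / n.+1%:R) (pat n w) j| @[n --> \oo] -->
        running_max (fun s w => `|U s w|) t w].
Proof.
move=> v0 rate0 [e [N [He [HN [indep HU]]]]] t0.
have rate_half_int := HN.1.
have rate_int u (u0 : 0 <= u) := integrable_half (rate_half_int u u0).
have [_ [_ [_ [Nmono _]]]] := HN.
have h0 n : 0 <= t / n.+1%:R by rewrite divr_ge0.
have nh n : n.+1%:R * (t / n.+1%:R) = t by rewrite mulrC divfK.
pose x n w i := odd (e w + N (i%:R * (t / n.+1%:R))%R w).
pose pat n w := pattern n.+1 (x n w).
pose g w k := v * (-1) ^+ (e w + k).
have gv w k : `|g w k| <= v.
  by rewrite /g normrM normrX normrN1 expr1n mulr1 ger0_norm.
have UE s w : 0 <= s -> U s w = \int[lebesgue_measure]_(u in `[0, s]) g w (N u w).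
  by move=> s0; rewrite HU.
have walkE n w j : (j <= n.+1)%N -> pattern_walk v (t / n.+1%:R) (pat n w) j =
    t / n.+1%:R * \sum_(i < j) g w (N (i%:R * (t / n.+1%:R)) w).
  move=> jn; rewrite pattern_walkE// /bit_walk; congr (_ * _).
  by apply: eq_bigr => i _; rewrite /g /x signr_odd.
have approx n w j : (j <= n.+1)%N ->
    `|U (j%:R * (t / n.+1%:R)) w - pattern_walk v (t / n.+1%:R) (pat n w) j| <=
    2 * v * (N t w)%:R * (t / n.+1%:R).
  move=> jn; rewrite walkE// UE ?mulr_ge0//.
  apply: (le_trans (counting_path_riemann j (Nmono w) (gv w) (h0 n))).
  rewrite mulrAC ler_wpM2r// ler_wpM2l ?mulr_ge0// ler_nat Nmono ?mulr_ge0//.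
  by rewrite -[leRHS](nh n) ler_wpM2r// ler_nat.
exists pat; split.
- move=> n G.
  have mean0 i := cell_mean_ge0 i rate0 rate_int (h0 n).
  have mean2 i := cell_mean_half i rate_half_int (h0 n).
  exact: (@telegraph_pattern_law _ _ _ P rate N e _ n.+1 G HN He indep (h0 n)
    mean0 mean2).
- move=> w; apply: cvg_of_mesh_bound => n.
  by have := approx n w n.+1 (leqnn _); rewrite nh; apply.
- move=> w; apply: (@running_max_limit R (fun s => `|U s w|) t v
    (2 * v * (N t w)%:R)
    (fun n j => `|pattern_walk v (t / n.+1%:R) (pat n w) j|)) => //.
  + by rewrite !mulr_ge0.
  + move=> s u s0 su ut; apply: (le_trans (ler_dist_dist _ _)).
    rewrite !UE//; last exact: le_trans su.
    exact: (counting_path_lipschitz (Nmono w) (gv w) s0 su).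
  + move=> n j jn; apply: (le_trans (ler_dist_dist _ _)); exact: approx.
Qed.

Lemma direction_sum_diff (R : realType) (k : 'Z_4) :
  (direction R k).1 + (direction R k).2 = (-1) ^+ sum_bit k /\
  (direction R k).1 - (direction R k).2 = (-1) ^+ diff_bit k.
Proof.
have val0 : (0 : 'Z_4) = 0%N :> nat by [].
have val1 : (1 : 'Z_4) = 1%N :> nat by [].
have val2 : (1 + 1 : 'Z_4) = 2%N :> nat by [].
have val3 : (- 1 : 'Z_4) = 3%N :> nat by [].
rewrite /direction; elim/Z4_cases: k.
- by rewrite val0 /= !mul0r cos0 sin0 addr0 subr0.
- by rewrite val1 /= mul1r cos_pihalf sin_pihalf add0r sub0r.
- by rewrite val2 /= mulrAC divff// mul1r cospi sinpi addr0 subr0.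
- rewrite val3 /=; have -> : 3%N%:R * pi / 2 = pi + pi / 2 :> R by lra.
  rewrite cosD sinD cospi sinpi cos_pihalf sin_pihalf.
  split; lra.
Qed.

Lemma direction_norm (R : realType) (k : 'Z_4) :
  `|(direction R k).1| <= 1 /\ `|(direction R k).2| <= 1.
Proof.
by rewrite !ler_norml cos_geN1 cos_le1 sin_geN1 sin_le1.
Qed.

Lemma norm_add_max (R : realType) (x y a b : R) :
  x + y = a * 2 -> x - y = b * 2 -> `|x| + `|y| = Num.max `|a| `|b| * 2.
Proof.
move=> xy1 xy2; have -> : x = a + b by lra.
have -> : y = a - b by lra.
by case: (lerP `|a| `|b|); do 4 (case: ler0P => ?); move=> ?; lra.
Qed.

(** The Riemann sums of the velocities of [(X + Y) / 2] and [(X - Y) / 2] are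
    determined by the two sign patterns, and [norm_add_max] recovers
    [|X| + |Y|]. *)
Lemma planar_approx (R : realType) (d : measure_display)
    (T : measurableType d) (P : probability T R) (c : R) (rate : R -> R)
    (X Y : R -> T -> R) (t : R) :
  0 <= c -> (forall t : R, 0 < t -> 0 <= rate t) ->
  is_orthogonal_planar_motion P c rate X Y -> 0 <= t ->
  exists pat pat' : forall n : nat, T -> {ffun 'I_n.+2 -> bool},
  let walk n p := pattern_walk (c / 2) (t / n.+1%:R) p in
  [/\ forall n (G H : pred {ffun 'I_n.+2 -> bool}),
        measurable [set w | G (pat n w) && H (pat' n w)] /\
        P [set w | G (pat n w) && H (pat' n w)] =
        (pattern_mass rate (t / n.+1%:R) G * pattern_mass rate (t / n.+1%:R) H)%:E,
      forall w, Num.max `|walk n (pat n w) n.+1| `|walk n (pat' n w) n.+1| * 2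
        @[n --> \oo] --> l1_distance X Y t w
    & forall w, \big[Num.max/0]_(j < n.+2)
        (Num.max `|walk n (pat n w) j| `|walk n (pat' n w) j| * 2) @[n --> \oo] -->
        running_max (l1_distance X Y) t w].
Proof.
move=> c0 rate0 [N [k0 [xi [HN [Hk [Hxi [indep HXY]]]]]]] t0.
have rate_int := HN.1.
have [_ [_ [_ [Nmono _]]]] := HN.
have h0 n : 0 <= t / n.+1%:R by rewrite divr_ge0.
have nh n : n.+1%:R * (t / n.+1%:R) = t by rewrite mulrC divfK.
pose D n w i := direction_index k0 xi (N (i%:R * (t / n.+1%:R)) w) w.
pose pat n w := pattern n.+1 (fun i => sum_bit (D n w i)).
pose pat' n w := pattern n.+1 (fun i => diff_bit (D n w i)).
pose gx w k := c * (direction R (direction_index k0 xi k w)).1.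
pose gy w k := c * (direction R (direction_index k0 xi k w)).2.
have gxc w k : `|gx w k| <= c.
  by rewrite normrM (ger0_norm c0) ler_piMr// (direction_norm _ _).1.
have gyc w k : `|gy w k| <= c.
  by rewrite normrM (ger0_norm c0) ler_piMr// (direction_norm _ _).2.
have XE s w : 0 <= s -> X s w = \int[lebesgue_measure]_(u in `[0, s]) gx w (N u w).
  by move=> s0; rewrite (HXY s w s0).1.
have YE s w : 0 <= s -> Y s w = \int[lebesgue_measure]_(u in `[0, s]) gy w (N u w).
  by move=> s0; rewrite (HXY s w s0).2.
pose Xd n w j := t / n.+1%:R * \sum_(i < j) gx w (N (i%:R * (t / n.+1%:R)) w).
pose Yd n w j := t / n.+1%:R * \sum_(i < j) gy w (N (i%:R * (t / n.+1%:R)) w).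
have walkE n w j : (j <= n.+1)%N ->
    Num.max `|pattern_walk (c / 2) (t / n.+1%:R) (pat n w) j|
            `|pattern_walk (c / 2) (t / n.+1%:R) (pat' n w) j| * 2 =
    `|Xd n w j| + `|Yd n w j|.
  move=> jn; rewrite !pattern_walkE//; apply/esym/norm_add_max.
    rewrite /Xd /Yd /bit_walk -mulrDr -[RHS]mulrA -big_split /= mulr_suml.
    congr (_ * _); apply: eq_bigr => i _; rewrite /gx /gy -mulrDr.
    by rewrite (direction_sum_diff _ _).1 mulrAC divfK.
  rewrite /Xd /Yd /bit_walk -mulrBr -[RHS]mulrA -sumrB /= mulr_suml.
  congr (_ * _); apply: eq_bigr => i _; rewrite /gx /gy -mulrBr.
  by rewrite (direction_sum_diff _ _).2 mulrAC divfK.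
have norm_close (x y x' y' A B : R) : `|x - x'| <= A -> `|y - y'| <= B ->
    `|(`|x| + `|y|) - (`|x'| + `|y'|)| <= A + B.
  move=> xA yB.
  rewrite (_ : _ - _ = (`|x| - `|x'|) + (`|y| - `|y'|)); last by ring.
  apply: (le_trans (ler_normD _ _)).
  by rewrite lerD// (le_trans (ler_dist_dist _ _)).
have approx n w j : (j <= n.+1)%N ->
    `|l1_distance X Y (j%:R * (t / n.+1%:R)) w - (`|Xd n w j| + `|Yd n w j|)| <=
    4 * c * (N t w)%:R * (t / n.+1%:R).
  move=> jn.
  have Njt : 2 * c * (t / n.+1%:R) * (N (j%:R * (t / n.+1%:R)) w)%:R <=
      2 * c * (N t w)%:R * (t / n.+1%:R).
    rewrite mulrAC ler_wpM2r// ler_wpM2l ?mulr_ge0// ler_nat Nmono ?mulr_ge0//.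
    by rewrite -[leRHS](nh n) ler_wpM2r// ler_nat.
  have -> : 4 * c * (N t w)%:R * (t / n.+1%:R) =
    2 * c * (N t w)%:R * (t / n.+1%:R) + 2 * c * (N t w)%:R * (t / n.+1%:R) by ring.
  apply: norm_close.
    rewrite XE ?mulr_ge0//; apply: le_trans Njt.
    exact: (counting_path_riemann j (Nmono w) (gxc w) (h0 n)).
  rewrite YE ?mulr_ge0//; apply: le_trans Njt.
  exact: (counting_path_riemann j (Nmono w) (gyc w) (h0 n)).
exists pat, pat'; split.
- move=> n G H.
  have mean0 i := cell_mean_ge0 i rate0 rate_int (h0 n).
  exact: (@planar_pattern_law _ _ _ P rate N k0 xi _ n.+1 G H HN Hk Hxi indep
    (h0 n) mean0).
- move=> w; apply: cvg_of_mesh_bound => n.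
  rewrite walkE//.
  by have := approx n w n.+1 (leqnn _); rewrite nh; apply.
- move=> w.
  apply: (@running_max_limit R (fun s => l1_distance X Y s w) t (c + c)
    (4 * c * (N t w)%:R)
    (fun n j => Num.max `|pattern_walk (c / 2) (t / n.+1%:R) (pat n w) j|
      `|pattern_walk (c / 2) (t / n.+1%:R) (pat' n w) j| * 2)) => //.
  + by rewrite addr_ge0.
  + by rewrite !mulr_ge0.
  + by move=> s; rewrite addr_ge0.
  + move=> s u s0 su ut; rewrite mulrDl; apply: norm_close.
      rewrite !XE//; last exact: le_trans su.
      exact: (counting_path_lipschitz (Nmono w) (gxc w) s0 su).
    rewrite !YE//; last exact: le_trans su.
    exact: (counting_path_lipschitz (Nmono w) (gyc w) s0 su).
  + by move=> n j jn; rewrite walkE//; exact: approx.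
Qed.

(** * Comparison of the distributions *)

Lemma bigmax_max_le (R : realType) (n : nat) (f g : 'I_n -> R) (x : R) :
  (\big[Num.max/0]_i (Num.max (f i) (g i) * 2) <= x) =
  ((\big[Num.max/0]_i f i * 2 <= x) && (\big[Num.max/0]_i g i * 2 <= x)).
Proof.
rewrite -!ler_pdivlMr//; apply/idP/andP.
  move=> /bigmax_leP[x0 H]; have x20 : 0 <= x / 2 by rewrite divr_ge0.
  split; apply/bigmax_leP; split=> // i _; have := H i isT;
  by rewrite -ler_pdivlMr// ge_max => /andP[].
move=> [/bigmax_leP[x0 fx] /bigmax_leP[_ gx]]; apply/bigmax_leP; split.
  by move: x0; lra.
by move=> i _; rewrite -ler_pdivlMr// ge_max fx// gx.
Qed.

Lemma distribution_square_transfer (R : realType)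
    (d : measure_display) (T : measurableType d) (P : probability T R)
    (d' : measure_display) (T' : measurableType d') (Q : probability T' R)
    (Xn : nat -> T -> R) (X : T -> R) (Yn : nat -> T' -> R) (Y : T' -> R)
    (b : R) :
  (forall n, measurable_fun setT (Xn n)) ->
  (forall w, Xn n w @[n --> \oo] --> X w) ->
  (forall n, measurable_fun setT (Yn n)) ->
  (forall w, Yn n w @[n --> \oo] --> Y w) ->
  (forall n x, fine (P [set w | Xn n w <= x]) =
               fine (Q [set w | Yn n w <= x]) ^+ 2) ->
  P [set w | X w <= b] = (Q [set w | (Y w <= b)%R] ^+ 2)%E.
Proof.
move=> mXn cvX mYn cvY law.
have mX : measurable_fun setT X by apply: measurable_fun_cvg mXn _ => w _.
have mY : measurable_fun setT Y by apply: measurable_fun_cvg mYn _ => w _.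
have sqr_cont : continuous (fun x : R => x ^+ 2).
  by move=> x; exact: exprn_continuous.
have := distribution_limit_transfer b sqr_cont mXn cvX mYn cvY law.
have fP := fin_num_measure P _ (measurable_le_level mX b).
have fQ := fin_num_measure Q _ (measurable_le_level mY b).
move=> e; rewrite -(fineK fP) -(fineK fQ) -EFin_expe; congr EFin.
exact: e.
Qed.

(** At every mesh, the distribution function of the discretized planar motion
    is the square of that of the discretized telegraph process: the maximum of
    the two independent walks is at most [x] when both of them are. *)
Lemma square_distribution (R : realType) (c : R) (rate : R -> R)
    (d : measure_display) (T : measurableType d) (P : probability T R)
    (X Y : R -> T -> R)
    (d' : measure_display) (T' : measurableType d') (Q : probability T' R)
    (U : R -> T' -> R) (t : R) :
  0 <= c -> (forall t : R, 0 < t -> 0 <= rate t) ->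
  is_orthogonal_planar_motion P c rate X Y ->
  is_telegraph_process Q (c / 2) (fun s => rate s / 2) U -> 0 <= t ->
  [/\ measurable_fun setT (l1_distance X Y t),
      forall b, P [set w | l1_distance X Y t w <= b] =
        (Q [set w | (`|U t w| <= b / 2)%R] ^+ 2)%E
    & forall b, P [set w | running_max (l1_distance X Y) t w <= b] =
        (Q [set w | (running_max (fun s w => `|U s w|) t w <= b / 2)%R] ^+ 2)%E].
Proof.
move=> c0 rate0 HXY HU t0.
have [pat [pat' [lawP cvZ cvZmax]]] := planar_approx c0 rate0 HXY t0.
have c20 : 0 <= c / 2 by rewrite divr_ge0.
have [patU [lawU cvU cvUmax]] := telegraph_approx c20 rate0 HU t0.
pose W n (p : {ffun 'I_n.+2 -> bool}) j := pattern_walk (c / 2) (t / n.+1%:R) p j.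
pose G n (x : R) : pred {ffun 'I_n.+2 -> bool} := fun p => `|W n p n.+1| * 2 <= x.
pose Gm n (x : R) : pred {ffun 'I_n.+2 -> bool} := fun p =>
  \big[Num.max/0]_(j < n.+2) `|W n p j| * 2 <= x.
have levU x n : [set w | `|W n (patU n w) n.+1| * 2 <= x] =
    [set w | G n x (patU n w)] by [].
have levZ x n :
    [set w | Num.max `|W n (pat n w) n.+1| `|W n (pat' n w) n.+1| * 2 <= x] =
    [set w | G n x (pat n w) && G n x (pat' n w)].
  by apply/seteqP; split=> w /=; rewrite /G -!ler_pdivlMr// ge_max.
have levUm x n : [set w | \big[Num.max/0]_(j < n.+2) `|W n (patU n w) j| * 2 <= x] =
    [set w | Gm n x (patU n w)] by [].
have levZm x n : [set w | \big[Num.max/0]_(j < n.+2)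
      (Num.max `|W n (pat n w) j| `|W n (pat' n w) j| * 2) <= x] =
    [set w | Gm n x (pat n w) && Gm n x (pat' n w)].
  by apply/seteqP; split=> w /=; rewrite /Gm bigmax_max_le.
have mZ n : measurable_fun setT
    (fun w => Num.max `|W n (pat n w) n.+1| `|W n (pat' n w) n.+1| * 2).
  by apply: measurable_fun_le_level => x; rewrite levZ; exact: (lawP n (G n x) (G n x)).1.
split=> [|b|b]; first by apply: measurable_fun_cvg mZ _ => w _; exact: cvZ.
- have -> : [set w | `|U t w| <= b / 2] = [set w | `|U t w| * 2 <= b].
    by apply/seteqP; split=> w /=; rewrite ler_pdivlMr.
  apply: (distribution_square_transfer b mZ cvZ
    (Yn := fun n w => `|W n (patU n w) n.+1| * 2) (Y := fun w => `|U t w| * 2)).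
  + move=> n; apply: measurable_fun_le_level => x; rewrite levU.
    exact: (lawU n (G n x)).1.
  + move=> w /=; apply: cvgM; last exact: cvg_cst.
    exact: cvg_norm (cvU w).
  + by move=> n x; rewrite levZ levU (lawP n (G n x) (G n x)).2 (lawU n (G n x)).2 /= expr2.
have -> : [set w | running_max (fun s w => `|U s w|) t w <= b / 2] =
    [set w | running_max (fun s w => `|U s w|) t w * 2 <= b].
  by apply/seteqP; split=> w /=; rewrite ler_pdivlMr.
apply: (distribution_square_transfer b _ cvZmax
  (Yn := fun n w => \big[Num.max/0]_(j < n.+2) `|W n (patU n w) j| * 2)
  (Y := fun w => running_max (fun s w => `|U s w|) t w * 2)).
- move=> n; apply: measurable_fun_le_level => x; rewrite levZm.
  exact: (lawP n (Gm n x) (Gm n x)).1.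
- move=> n; apply: measurable_fun_le_level => x; rewrite levUm.
  exact: (lawU n (Gm n x)).1.
- move=> w; apply: cvgM; last exact: cvg_cst.
  exact: cvUmax.
- by move=> n x; rewrite levZm levUm (lawP n (Gm n x) (Gm n x)).2 (lawU n (Gm n x)).2 /= expr2.
Qed.

(** The flips are unchanged when all the signs are reversed. *)
Lemma pattern_mass_negb (R : realType) (rate : R -> R) (h : R) (m : nat)
    (G : pred {ffun 'I_m.+1 -> bool}) :
  pattern_mass rate h (fun p => G [ffun i => ~~ p i]) = pattern_mass rate h G.
Proof.
have negb_inj' : injective (fun p : {ffun 'I_m.+1 -> bool} => [ffun i => ~~ p i]).
  move=> p q /ffunP pq; apply/ffunP => i; have := pq i; rewrite !ffunE.
  exact: negb_inj.
rewrite /pattern_mass [RHS](reindex_inj negb_inj').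
apply: eq_bigr => p _; congr (_ * _); apply: eq_bigr => i _; congr cell_prob.
by rewrite !ffunE; case: (p _) (p _) => -[].
Qed.

Lemma pattern_walk_negb (R : realType) (v h : R) (m : nat)
    (p : {ffun 'I_m.+1 -> bool}) (j : nat) :
  pattern_walk v h [ffun i => ~~ p i] j = - pattern_walk v h p j.
Proof.
rewrite /pattern_walk /bit_walk -mulrN -sumrN; congr (_ * _).
by apply: eq_bigr => i _; rewrite ffunE signrN mulrN.
Qed.

(** The law of the sign patterns only depends on the rate, and it is symmetric
    by [pattern_mass_negb]. *)
Lemma telegraph_distribution (R : realType) (v : R) (rate : R -> R)
    (d : measure_display) (T : measurableType d) (P : probability T R)
    (U V : R -> T -> R) (t b : R) :
  0 <= v -> (forall t : R, 0 < t -> 0 <= rate t) ->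
  is_telegraph_process P v (fun s => rate s / 2) U ->
  is_telegraph_process P v (fun s => rate s / 2) V -> 0 <= t ->
  fine (P [set w | U t w <= b]) = fine (P [set w | V t w <= b]) /\
  fine (P [set w | - U t w <= b]) = fine (P [set w | U t w <= b]).
Proof.
move=> v0 rate0 HU HV t0.
have [patU [lawU cvU _]] := telegraph_approx v0 rate0 HU t0.
have [patV [lawV cvV _]] := telegraph_approx v0 rate0 HV t0.
have id_cont : continuous (fun x : R => x) by move=> x.
pose W n p := @pattern_walk R v (t / n.+1%:R) n.+1 p n.+1.
pose G n (x : R) : pred {ffun 'I_n.+2 -> bool} := fun p => W n p <= x.
have levU (x : R) n : [set w | W n (patU n w) <= x]
    = [set w | G n x (patU n w)] by [].
pose G' n (x : R) : pred {ffun 'I_n.+2 -> bool} := fun p => - W n p <= x.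
have levN (x : R) n : [set w | - W n (patU n w) <= x]
    = [set w | G' n x (patU n w)] by [].
have levV (x : R) n : [set w | W n (patV n w) <= x]
    = [set w | G n x (patV n w)] by [].
have mU n : measurable_fun setT (fun w => W n (patU n w)).
  by apply: measurable_fun_le_level => x; rewrite levU; exact: (lawU n (G n x)).1.
split.
  apply: (distribution_limit_transfer b id_cont mU cvU _ cvV).
    by move=> n; apply: measurable_fun_le_level => x; rewrite levV; exact: (lawV n (G n x)).1.
  by move=> n x; rewrite levU levV (lawU n (G n x)).2 (lawV n (G n x)).2.
apply: (distribution_limit_transfer b id_cont _ _ mU cvU
  (Xn := fun n w => - W n (patU n w))).
- by move=> n; apply: measurable_fun_le_level => x; rewrite levN; exact: (lawU n (G' n x)).1.
- by move=> w; apply: cvgN; exact: cvU.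
- move=> n x; rewrite levN levU (lawU n (G n x)).2 (lawU n (G' n x)).2 /=.
  rewrite -[RHS]pattern_mass_negb; congr pattern_mass; apply/funext => p.
  by rewrite /G /G' /W pattern_walk_negb.
Qed.

Lemma telegraph_measurable (R : realType) (v : R) (rate : R -> R)
    (d : measure_display) (T : measurableType d) (P : probability T R)
    (U : R -> T -> R) (t : R) :
  0 <= v -> (forall t : R, 0 < t -> 0 <= rate t) ->
  is_telegraph_process P v (fun s => rate s / 2) U -> 0 <= t ->
  measurable_fun setT (U t).
Proof.
move=> v0 rate0 HU t0.
have [patU [lawU cvU _]] := telegraph_approx v0 rate0 HU t0.
pose W n p := @pattern_walk R v (t / n.+1%:R) n.+1 p n.+1.
pose G n (x : R) : pred {ffun 'I_n.+2 -> bool} := fun p => W n p <= x.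
have levU (x : R) n : [set w | W n (patU n w) <= x]
    = [set w | G n x (patU n w)] by [].
apply: (@measurable_fun_cvg _ _ _ _ (fun n w => W n (patU n w))); last first.
  by move=> w _; exact: cvU.
move=> n; apply: measurable_fun_le_level => x; rewrite levU.
exact: (lawU n (G n x)).1.
Qed.

(** * Moving the last flip *)

(** The indices satisfying [p] lie between the least and the greatest of them,
    whose distance times [D] is at most [l]. *)
Lemma count_spread (R : realType) (p : pred nat) (m : nat) (D l : R) :
  0 <= D -> 0 <= l ->
  (forall i j, p i -> p j -> (i <= j < m)%N -> (j%:R - i%:R) * D <= l) ->
  (\sum_(i < m) (p i)%:R) * D <= l + D.
Proof.
move=> D0 l0 spread; pose s := seq.filter p (iota 0 m).
have -> : \sum_(i < m) (p i)%:R = (size s)%:R :> R.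
  rewrite -(big_mkord predT (fun i => (p i)%:R)) -natr_sum size_filter -sum1_count.
  by rewrite [in RHS]big_mkcond /index_iota subn0; congr _%:R;
    apply: eq_bigr => i _; case: (p i).
have [s0|s0] := posnP (size s); first by rewrite s0 mul0r addr_ge0.
have ex : exists i, i \in s by exists (nth 0%N s 0); exact: mem_nth.
have bnd i : i \in s -> (i <= m)%N.
  by rewrite mem_filter mem_iota => /andP[_ /andP[_ /ltnW]].
case: (ex_minnP ex) => i0 i0s i0min; case: (ex_maxnP ex bnd) => i1 i1s i1max.
have i01 : (i0 <= i1)%N by exact: i0min.
have sz : (size s <= i1.+1 - i0)%N.
  rewrite -(size_iota i0 (i1.+1 - i0)); apply: uniq_leq_size.
    by rewrite filter_uniq// iota_uniq.
  move=> i si; rewrite mem_iota i0min//= subnKC; last by rewrite leqW.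
  by rewrite ltnS i1max.
have : (size s)%:R <= i1%:R - i0%:R + 1 :> R.
  by rewrite -natrB// natr1 -subSn// ler_nat.
have := spread i0 i1.
move: i0s i1s; rewrite !mem_filter !mem_iota => /andP[p0 _] /andP[p1 /andP[_ im]].
rewrite p0 p1 i01 im => /(_ isT isT isT) sp szR.
apply: le_trans (ler_wpM2r D0 szR) _; lra.
Qed.

(** Creates, or removes, a flip in the cell from [i] to [i + 1]. *)
Definition flip_after (m : nat) (i : nat) (q : {ffun 'I_m.+1 -> bool}) :
    {ffun 'I_m.+1 -> bool} := [ffun j : 'I_m.+1 => q j (+) (i < j)%N].

Lemma flip_after_inj (m i : nat) : injective (@flip_after m i).
Proof.
move=> p q /ffunP pq; apply/ffunP => j; have := pq j; rewrite !ffunE.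
exact: addIb.
Qed.

Definition constant_from (m : nat) (i : nat) (q : {ffun 'I_m.+1 -> bool}) : bool :=
  all (fun j => q (inord j) == q (inord m)) (iota i (m.+1 - i)).

Lemma constant_fromP (m i : nat) (q : {ffun 'I_m.+1 -> bool}) :
  reflect (forall j, (i <= j <= m)%N -> q (inord j) = q (inord m))
    (constant_from i q).
Proof.
apply: (iffP allP) => H j.
  move=> /andP[ij jm]; apply/eqP/H; rewrite mem_iota ij /= subnKC ?ltnS//.
  by rewrite (leq_trans ij)// ltnW.
rewrite mem_iota => /andP[ij jm]; apply/eqP/H; rewrite ij /= -ltnS.
have [im|im] := leqP i m.+1; first by rewrite subnKC in jm.
by move: jm; rewrite (eqP (ltnW im : (m.+1 - i == 0)%N)) addn0 ltnNge ij.
Qed.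

(** After time [i + 1] the path is a straight line of [m - i - 1] steps, which
    gets reflected. *)
Lemma pattern_walk_flip_after (R : realType) (v h : R) (m i : nat)
    (q : {ffun 'I_m.+1 -> bool}) : (i < m)%N -> constant_from i q ->
  pattern_walk v h (flip_after i q) m =
  pattern_walk v h q m - 2 * h * v * (-1) ^+ q (inord m) * (m%:R - i.+1%:R).
Proof.
move=> im /constant_fromP qc.
have cnt : \sum_(j < m) (i < j)%:R = m%:R - i.+1%:R :> R.
  rewrite -(big_mkord predT (fun j => (i < j)%:R)) (big_cat_nat _ (n := i.+1))//=.
  rewrite big1_seq ?add0r; last first.
    by move=> j; rewrite mem_index_iota /= => ji; rewrite ltnNge -ltnS ji.
  rewrite (eq_big_nat _ _ (F2 := fun=> 1)) => [|j /andP[ij _]]; last by rewrite ij.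
  by rewrite sumr_const_nat natrB.
rewrite /pattern_walk /bit_walk -cnt.
rewrite [X in _ - X](_ : _ = h * \sum_(j < m)
  (2 * v * (-1) ^+ q (inord m) * (i < j)%:R)); last first.
  rewrite -mulr_sumr; ring.
rewrite -mulrBr -sumrB; congr (_ * _); apply: eq_bigr => j _.
rewrite ffunE inordK; last by rewrite ltnS ltnW.
have [ij|ij] := ltnP i j; last by rewrite addbF mulr0n mulr0 subr0.
rewrite addbT (qc j); last by rewrite (ltnW ij) (ltnW (ltn_ord j)).
rewrite signrN mulr1n; ring.
Qed.

(** Only the factor of the cell [i] changes, from no flip to a flip, and
    [1 - exp (- x) <= x (1 + exp (- x))]. *)
Lemma grid_weight_flip_after (R : realType) (rate : R -> R) (h a : R)
    (m i : nat) (q : {ffun 'I_m.+1 -> bool}) :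
  (forall j, 0 <= cell_mean rate h j) ->
  cell_mean rate h i <= a -> (i < m)%N -> q (inord i) = q (inord i.+1) ->
  grid_weight rate h m (fun j => flip_after i q (inord j)) <=
  a * grid_weight rate h m (fun j => q (inord j)).
Proof.
move=> mean0 ma im qi.
have cell0 j b : 0 <= cell_prob (cell_mean rate h j) b.
  rewrite divr_ge0//; case: b; rewrite ?expr1 ?expr0.
    by rewrite mulN1r subr_ge0 expR_le1 oppr_le0.
  by rewrite mul1r addr_ge0// expR_ge0.
rewrite /grid_weight mulrCA ler_wpM2l// (bigD1 (Ordinal im))//=.
rewrite [in leRHS](bigD1 (Ordinal im))//= mulrA.
rewrite !ffunE !inordK// ?ltnS ?(ltnW im)// qi ltnn ?leqnn ?ltnSn addbF addbT addbb.
rewrite addbN addbb /=.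
rewrite [X in _ * X](eq_bigr (fun j : 'I_m => cell_prob (cell_mean rate h j)
  (q (inord j) (+) q (inord j.+1)))); last first.
  move=> j; rewrite -val_eqE /= => ji; congr cell_prob; rewrite !ffunE.
  rewrite !inordK// ?ltnS ?(ltnW (ltn_ord j))// addbACA.
  have -> : (i <= j)%N = (i < j)%N by rewrite leq_eqVlt [i == j :> nat]eq_sym (negPf ji).
  by rewrite addbb addbF.
rewrite ler_wpM2r ?prodr_ge0// /cell_prob expr1 expr0 mulN1r mul1r.
have e1 := expR_ge1Dx (- cell_mean rate h i).
have e0 := expR_ge0 (- cell_mean rate h i).
have a0 : 0 <= a by apply: le_trans ma.
have : 0 <= a * expR (- cell_mean rate h i) by rewrite mulr_ge0.
lra.
Qed.

Lemma sum_sign_bounds (R : realType) (n : nat) (x : nat -> bool) :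
  `|\sum_(i < n) (-1) ^+ x i| <= n%:R :> R.
Proof.
apply: (le_trans (ler_norm_sum _ _ _)).
rewrite (eq_bigr (fun=> 1)); last by move=> i _; rewrite normrX normrN1 expr1n.
by rewrite sumr_const card_ord.
Qed.

(** The constant part makes [m - i] steps in one direction, of which the other
    steps undo at most [i]. *)
Lemma pattern_walk_constant_from (R : realType) (v h : R) (m i : nat)
    (p : {ffun 'I_m.+1 -> bool}) :
  0 <= v -> 0 <= h -> (i <= m)%N -> constant_from i p ->
  v * h * (m%:R - 2 * i%:R) <= `|pattern_walk v h p m|.
Proof.
move=> v0 h0 im /constant_fromP pc.
have -> : pattern_walk v h p m = v * h * (\sum_(j < i) (-1) ^+ p (inord j) +
    (m%:R - i%:R) * (-1) ^+ p (inord m)).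
  rewrite /pattern_walk /bit_walk -mulr_sumr mulrCA mulrA; congr (_ * _).
  rewrite -(big_mkord predT (fun j => (-1) ^+ p (inord j))) (big_cat_nat _ (n := i))//=.
  rewrite big_mkord; congr (_ + _).
  rewrite (eq_big_nat _ _ (F2 := fun=> (-1) ^+ p (inord m))).
    by rewrite sumr_const_nat -natrB// mulr_natl.
  by move=> j /andP[ij jm]; rewrite pc// ij ltnW.
have vh0 : 0 <= v * h by rewrite mulr_ge0.
rewrite normrM ger0_norm// ler_wpM2l//.
have := sum_sign_bounds R i (fun j => p (inord j)).
set s := \sum_(j < i) _ => sb.
have mi : 0 <= m%:R - i%:R :> R by rewrite subr_ge0 ler_nat.
have : `|(m%:R - i%:R) * (-1) ^+ p (inord m)| = m%:R - i%:R :> R.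
  by rewrite normrM normrX normrN1 expr1n mulr1 ger0_norm.
set r := _ * _ => rE.
have := ler_normB (s + r) s; rewrite [s + r]addrC addrK rE.
lra.
Qed.

Lemma backward_index_bounds (i m k : nat) : (k < m - i)%N ->
  [/\ (m - k.+1).+1 = (m - k)%N, (i <= m - k.+1)%N & (m - k.+1 < m)%N].
Proof. by move=> km; split; lia. Qed.

(** Moving the last flip along the grid keeps the weight comparable and moves
    the end point with constant speed, so that few positions of it end in a
    given interval. *)
Lemma pattern_mass_interval (R : realType) (rate : R -> R) (v h delta K a b : R)
    (m : nat) :
  0 < v -> 0 < h -> 0 <= delta -> 0 <= K -> a <= b -> h * 2 <= delta ->
  (forall j, 0 <= cell_mean rate h j) ->
  (forall j, (j < m)%N -> delta <= j%:R * h -> cell_mean rate h j <= K * h) ->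
  - (v * (m%:R * h - 3 * delta)) <= a -> b <= v * (m%:R * h - 3 * delta) ->
  pattern_mass rate h (fun _ : {ffun 'I_m.+1 -> bool} => true) <= 1 ->
  pattern_mass rate h
    (fun p : {ffun 'I_m.+1 -> bool} => a < pattern_walk v h p m < b) <=
  K / (2 * v) * (b - a) + K * h.
Proof.
move=> v0 h0 dl0 K0 ab hdl mean0 meanK ra rb mass1.
pose G (p : {ffun 'I_m.+1 -> bool}) := a < pattern_walk v h p m < b.
pose w (p : {ffun 'I_m.+1 -> bool}) := grid_weight rate h m (fun i => p (inord i)).
have w0 p : 0 <= w p.
  rewrite mulr_ge0// prodr_ge0// => i _; rewrite divr_ge0//.
  case: (_ (+) _); rewrite ?expr1 ?expr0 ?mul1r ?mulN1r.
    by rewrite subr_ge0 expR_le1 oppr_le0.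
  by rewrite addr_ge0// expR_ge0.
pose late (i : 'I_m) := delta <= i%:R * h.
pose last_flip (i : 'I_m) (p : {ffun 'I_m.+1 -> bool}) :=
  (p (inord i) != p (inord i.+1)) && constant_from i.+1 p.
(* a path ending far from the extreme points has a late flip *)
have late_flip p : G p -> exists2 i, late i & last_flip i p.
  move=> /andP[aS Sb].
  have hv0 : 0 <= v * h by rewrite mulr_ge0// ltW.
  have Slt : `|pattern_walk v h p m| < v * (m%:R * h - 3 * delta).
    by rewrite ltr_norml; apply/andP; split; lra.
  (* [i0 * h] is the first grid time after [delta] *)
  pose i0 := (Num.truncn (delta / h)).+1.
  have dh0 : 0 <= delta / h by rewrite divr_ge0// ltW.
  have /andP[j1 j2] := truncn_itv dh0.
  have i0_lo : delta <= i0%:R * h by rewrite -ler_pdivrMr// ltW.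
  have i0_hi : i0%:R * h <= delta + h.
    by rewrite /i0 -natr1 mulrDl mul1r lerD2r -ler_pdivlMr.
  have i0m : (i0 <= m)%N.
    rewrite leqNgt; apply/negP => mi0.
    have : m%:R * h <= i0%:R * h by rewrite ler_pM2r// ler_nat ltnW.
    have : 0 <= v * (m%:R * h - 3 * delta) by apply: le_trans (ltW Slt).
    rewrite pmulr_rge0//; lra.
  have nconst : ~~ constant_from i0 p.
    apply/negP => /(pattern_walk_constant_from (ltW v0) (ltW h0) i0m).
    have : v * (m%:R * h - 3 * delta) <= v * h * (m%:R - 2 * i0%:R).
      rewrite -mulrA ler_pM2l//; lra.
    lra.
  pose flips i := (i < m)%N && (p (inord i) != p (inord i.+1)).
  have [i /andP[i0i fi]] : exists i, (i0 <= i)%N && flips i.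
    apply: contrapT => nf; move/negP: nconst; apply; apply/constant_fromP => j.
    move=> /andP[ij jm]; move: jm ij.
    have main k : (k <= m - i0)%N -> p (inord (m - k)) = p (inord m).
      elim: k => [|k IH] km; first by rewrite subn0.
      rewrite -IH; last exact: ltnW.
      apply/eqP/negPn/negP => pk; apply: nf; exists (m - k.+1)%N.
      have [mk ik lt_m] := backward_index_bounds km.
      by rewrite /flips ik lt_m mk pk.
    move=> jm ij; rewrite -(main (m - j)%N); last by rewrite leq_sub2l.
    by rewrite subKn.
  have ex : exists i, flips i by exists i.
  have bnd j : flips j -> (j <= m)%N by move=> /andP[/ltnW].
  case: (ex_maxnP ex bnd) => k /andP[km pk] kmax.
  exists (Ordinal km); rewrite /late /last_flip /=.
    rewrite (le_trans i0_lo)// ler_pM2r// ler_nat (leq_trans i0i)//.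
    exact: kmax.
  rewrite pk /=; apply/constant_fromP => j /andP[kj jm].
  have main l : (l <= m - k.+1)%N -> p (inord (m - l)) = p (inord m).
    elim: l => [|l IH] lm; first by rewrite subn0.
    rewrite -IH; last exact: ltnW.
    apply/eqP/negPn/negP => pl.
    have [ml kl lt_m] := backward_index_bounds lm.
    have /kmax : flips (m - l.+1)%N by rewrite /flips lt_m ml pl.
    by rewrite leqNgt kl.
  rewrite -(main (m - j)%N); last by rewrite leq_sub2l.
  by rewrite subKn.
pose near_last (i : 'I_m) (q : {ffun 'I_m.+1 -> bool}) :=
  [&& late i, G (flip_after i q) & constant_from i q].
(* the paths are sorted by their last flip *)
have step1 : pattern_mass rate h G <=
    \sum_(i : 'I_m) \sum_(p | [&& late i, G p & last_flip i p]) w p.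
  rewrite /pattern_mass (exchange_big_dep G)/=; last by move=> i p _ /and3P[].
  apply: ler_sum => p Gp; have [i li fi] := late_flip p Gp.
  rewrite (bigD1 i) /=; last by rewrite li Gp fi.
  by rewrite lerDl sumr_ge0.
(* a path weighs at most [K * h] times as much as with its last flip undone *)
have step2 i : \sum_(p | [&& late i, G p & last_flip i p]) w p <=
    \sum_(q | near_last i q) K * h * w q.
  rewrite (reindex_inj (@flip_after_inj m i)) /=.
  have sub q : [&& late i, G (flip_after i q) & last_flip i (flip_after i q)] =
      near_last i q.
    rewrite /near_last; congr (_ && (_ && _)).
    rewrite /last_flip !ffunE !inordK ?ltnS//; last exact: ltnW.
    rewrite ltnn leqnn addbF addbT.
    apply/andP/idP => [[qi /constant_fromP qc]|/constant_fromP qc].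
      have qS j : (i < j <= m)%N -> q (inord j) = q (inord m).
        move=> /andP[ij jm]; have := qc j; rewrite ij jm !ffunE !inordK// ij.
        by rewrite ltn_ord => /(_ isT) /addIb.
      apply/constant_fromP => j; rewrite leq_eqVlt => /andP[/predU1P[<- _|ij jm]].
        by rewrite -(qS i.+1) ?ltn_ord ?leqnn//; move: qi; case: (q _) (q _) => -[].
      by rewrite qS// ij.
    split.
      rewrite (qc i) ?leqnn ?(ltnW (ltn_ord i))// (qc i.+1) ?leqnSn ?ltn_ord//.
      by case: (q _).
    apply/constant_fromP => j /andP[ij jm]; rewrite !ffunE !inordK// ij ltn_ord.
    by rewrite (qc j)// ltnW.
  under eq_bigl do rewrite sub.
  apply: ler_sum => q /and3P[li _ /constant_fromP qc].
  apply: grid_weight_flip_after => //; first exact: meanK.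
  rewrite (qc i) ?leqnn ?(ltnW (ltn_ord i))// (qc i.+1) ?leqnSn ?ltn_ord//.
(* two positions of the last flip that are [k] cells apart give end points at
   distance [2 * v * h * k], so that few positions end in the interval *)
have step3 q : (\sum_(i : 'I_m) (near_last i q)%:R) * (2 * v * h) <= (b - a) + 2 * v * h.
  pose P (i : nat) := if insub i is Some i' then near_last i' q else false.
  rewrite (eq_bigr (fun i : 'I_m => (P i)%:R)); last first.
    by move=> i _; rewrite /P insubT//= => im; 
      congr (nat_of_bool (near_last _ q))%:R; exact: val_inj.
  apply: count_spread; [by rewrite !mulr_ge0// ltW|by rewrite subr_ge0|].
  move=> i j; rewrite /P; case: insubP => // i' im i'E; case: insubP => // j' jm j'E.
  move=> /and3P[_ /andP[ai bi] ci] /and3P[_ /andP[aj bj] cj] /andP[ij _].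
  move: ai bi aj bj; rewrite !pattern_walk_flip_after// i'E j'E -!natr1.
  case: (q (inord m)); rewrite ?expr1 ?expr0 => ai bi aj bj; lra.
apply: (le_trans step1); apply: (le_trans (ler_sum _ (fun i _ => step2 i))).
rewrite (exchange_big_dep predT)//=.
have step4 q : \sum_(i | near_last i q) K * h * w q <=
    (K / (2 * v) * (b - a) + K * h) * w q.
  rewrite (_ : \sum_(i | near_last i q) K * h * w q =
     (\sum_(i : 'I_m) (near_last i q)%:R) * (K * h) * w q); last first.
    rewrite -[RHS]mulrA mulr_suml big_mkcond; apply: eq_bigr => i _.
    by case: (near_last i q); rewrite ?mul1r ?mul0r.
  rewrite ler_wpM2r//.
  rewrite (_ : _ * (K * h) = 
      (\sum_(i : 'I_m) (near_last i q)%:R) * (2 * v * h) * (K / (2 * v))).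
    rewrite (_ : _ + K * h = ((b - a) + 2 * v * h) * (K / (2 * v))).
      by rewrite ler_wpM2r// divr_ge0// mulr_ge0// ltW.
    by field; rewrite gt_eqF.
  by field; rewrite gt_eqF.
apply: (le_trans (ler_sum _ (fun q _ => step4 q))).
rewrite -mulr_sumr ler_piMr//; apply: addr_ge0.
  by rewrite mulr_ge0 ?subr_ge0 ?divr_ge0// mulr_ge0// ltW.
by rewrite mulr_ge0// ltW.
Qed.

(** * Absolute continuity away from the extreme points *)

Lemma cell_mean_le (R : realType) (rate : R -> R) (h K t : R) (i : nat) :
  (forall t : R, 0 <= t ->
     lebesgue_measure.-integrable `[0, t] (fun s => (rate s)%:E)) ->
  0 <= h -> i.+1%:R * h <= t ->
  (forall s, i%:R * h <= s <= t -> rate s <= K) ->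
  cell_mean rate h i <= K * h.
Proof.
move=> rate_int h0 iht rateK.
have ih0 : 0 <= i%:R * h by rewrite mulr_ge0.
have iS : i%:R * h <= i.+1%:R * h by rewrite ler_wpM2r// ler_nat.
have <- : \int[lebesgue_measure]_(u in `[i%:R * h, i.+1%:R * h]) K = K * h.
  rewrite Rintegral_cst//= lebesgue_measure_itv /= lte_fin.
  have hE : i.+1%:R * h - i%:R * h = h by rewrite -natr1; ring.
  case: ltP => [_|ts] /=; first by rewrite hE.
  by rewrite (_ : h = 0) ?mulr0//; apply/eqP; rewrite eq_le h0 andbT -hE subr_le0.
apply: le_Rintegral => //.
- apply: integrableS (rate_int (i.+1%:R * h) _) => //; last by rewrite mulr_ge0.
  by apply: subset_itv; rewrite bnd_simp.
- apply: measurable_bounded_integrable => //.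
    rewrite /= lebesgue_measure_itv /=; case: ifP => // _.
    by rewrite -EFinB ltry.
  by exists `|K|; split=> [|r vr x _] //=; rewrite ltW.
- move=> u /=; rewrite in_itv /= => /andP[iu ui].
  by apply: rateK; rewrite iu (le_trans ui).
Qed.

(** The bound of [pattern_mass_interval] passes to the limit, in which its term
    [K h] vanishes. *)
Lemma telegraph_interval_bound (R : realType) (v : R) (rate : R -> R)
    (d : measure_display) (T : measurableType d) (P : probability T R)
    (U : R -> T -> R) (t delta K a b : R) :
  0 < v -> (forall t : R, 0 < t -> 0 <= rate t) ->
  is_telegraph_process P v (fun s => rate s / 2) U -> 0 < t ->
  0 < delta -> 0 <= K -> (forall s, delta <= s <= t -> rate s <= K) ->
  - (v * (t - 3 * delta)) <= a -> a <= b -> b <= v * (t - 3 * delta) ->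
  fine (P [set w | a < U t w < b]) <= K / (2 * v) * (b - a).
Proof.
move=> v0 rate0 HU t0 dl0 K0 rateK ra ab rb.
have mU := telegraph_measurable (ltW v0) rate0 HU (ltW t0).
have [pat [lawU cvU _]] := telegraph_approx (ltW v0) rate0 HU (ltW t0).
have [e [N [_ [[rate_half_int _] _]]]] := HU.
have rate_int u (u0 : 0 <= u) := integrable_half (rate_half_int u u0).
have h0 n : 0 < t / n.+1%:R by rewrite divr_gt0.
have nh n : n.+1%:R * (t / n.+1%:R) = t by rewrite mulrC divfK.
pose W n p := @pattern_walk R v (t / n.+1%:R) n.+1 p n.+1.
pose G n : pred {ffun 'I_n.+2 -> bool} := fun p => a < W n p < b.
have mean0 n i := cell_mean_ge0 i rate0 rate_int (ltW (h0 n)).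
have bound n : t / n.+1%:R * 2 <= delta ->
    fine (P [set w | G n (pat n w)]) <= K / (2 * v) * (b - a) + K * (t / n.+1%:R).
  move=> hdl; rewrite (lawU n (G n)).2 /=.
  apply: (pattern_mass_interval v0 (h0 n) (ltW dl0) K0 ab hdl (mean0 n)).
  - move=> j jn dlj; apply: (@cell_mean_le _ _ _ _ t) => //; first exact: ltW.
      by rewrite -[leRHS](nh n) ler_pM2r// ler_nat.
    by move=> s /andP[js st]; apply: rateK; rewrite (le_trans dlj js).
  - by rewrite nh.
  - by rewrite nh.
  - have [mt Pt] := lawU n (fun=> true).
    by have := probability_le1 P mt; rewrite [X in (X <= _)%E -> _]Pt lee_fin.
have mA : measurable [set w | a < U t w < b].
  rewrite (_ : [set w | _] = setT `&` U t @^-1` `]a, b[).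
    by apply: mU.
  by apply/seteqP; split=> w /=; rewrite in_itv /= => // -[].
apply/ler_addgt0Pr => eta eta0.
have eta2 : 0 < eta / 2 by rewrite divr_gt0.
have conv : \forall n \near \oo,
    fine (P [set w | a < U t w < b]) - eta / 2 <= fine (P [set w | G n (pat n w)]).
  apply: (@probability_le_liminf _ _ _ _ _ (fun n => [set w | G n (pat n w)])) => //.
    by move=> n; exact: (lawU n (G n)).1.
  move=> w /= /andP[aU Ub].
  have [aU0 bU0] : 0 < U t w - a /\ 0 < b - U t w by rewrite !subr_gt0.
  have /cvgrPdist_lt cvw := cvU w.
  apply: filterS2 (cvw _ aU0) (cvw _ bU0) => n.
  rewrite !ltr_norml => /andP[_ n1] /andP[n2 _]; rewrite /G -/(W n _).
  by move: n1 n2; rewrite -/(W n _) => n1 n2; apply/andP; split; lra.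
have small : \forall n \near \oo, t / n.+1%:R * 2 <= delta.
  have /cvgrPdist_le /(_ (delta / 2)) := @cvg_mesh R t.
  rewrite divr_gt0// => /(_ isT); apply: filterS => n.
  by rewrite sub0r normrN ger0_norm ?(ltW (h0 n))// ler_pdivlMr.
have small' : \forall n \near \oo, K * (t / n.+1%:R) <= eta / 2.
  have : K * (t / n.+1%:R) @[n --> \oo] --> 0.
    by rewrite -[X in _ --> X](mulr0 K); apply: cvgM; [exact: cvg_cst|exact: cvg_mesh].
  move=> /cvgrPdist_le /(_ _ eta2); apply: filterS => n.
  by rewrite sub0r normrN; apply: le_trans; exact: ler_norm.
near \oo => n.
have h1 : fine (P [set w | a < U t w < b]) - eta / 2 <= fine (P [set w | G n (pat n w)]).
  by near: n.
have h2 : fine (P [set w | G n (pat n w)]) <= K / (2 * v) * (b - a) + K * (t / n.+1%:R).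
  by apply: bound; near: n.
have h3 : K * (t / n.+1%:R) <= eta / 2 by near: n.
move: h1; rewrite lerBlDr => /le_trans; apply.
by rewrite [leRHS](_ : _ = K / (2 * v) * (b - a) + eta / 2 + eta / 2);
  [rewrite lerD2r (le_trans h2)// lerD2l|rewrite -addrA -splitr].
Unshelve. all: by end_near. Qed.

Lemma open_itv_measurable (R : realType) (d : measure_display)
    (T : measurableType d) (X : T -> R) (a b : R) :
  measurable_fun setT X -> measurable [set w | a < X w < b].
Proof.
move=> mX; rewrite (_ : [set w | _] = setT `&` X @^-1` `]a, b[).
  by apply: mX.
by apply/seteqP; split=> w /=; rewrite in_itv /= => // -[].
Qed.

(** A null set is covered by open intervals of small total length, to which
    the bound applies after intersection with the interval from [- r] to
    [r]. *)
Lemma null_preimage_of_interval_bound (R : realType) (d : measure_display)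
    (T : measurableType d) (P : probability T R) (X : T -> R) (r C : R)
    (A : set R) :
  measurable_fun setT X -> 0 <= C ->
  (forall a b, - r <= a -> a <= b -> b <= r ->
     fine (P [set w | a < X w < b]) <= C * (b - a)) ->
  measurable A -> lebesgue_measure A = 0%E -> A `<=` `]- r, r[ ->
  P (X @^-1` A) = 0%E.
Proof.
move=> mX C0 bound mA A0 Ar.
have mXA : measurable (X @^-1` A).
  by rewrite -[X in measurable X]setTI; exact: mX.
apply/eqP; rewrite eq_le measure_ge0 andbT.
apply/lee_addgt0Pr => eps eps0; rewrite add0e.
have e0 : 0 < eps / (C + 1) by rewrite divr_gt0// ltr_wpDl.
have := outer_measure_open_itv_cover A.
have -> : ((wlength idfun)^*)%mu A = 0%E by exact: A0.
move=> /esym inf0.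
have : ereal_inf [set (\sum_(k <oo) wlength idfun (F k))%E | F in open_itv_cover A]
    \is a fin_num by rewrite inf0.
move=> /(lb_ereal_inf_adherent e0)[_ [F [Fitv AF] <-]].
rewrite inf0 add0e => sumF.
pose B k := [set w | - r < X w < r /\ F k (X w)].
have Bk k : measurable (B k) /\ (P (B k) <= C%:E * wlength idfun (F k))%E.
  have [[a b] Fk] := Fitv k.
  have -> : B k = [set w | Num.max a (- r) < X w < Num.min b r].
    apply/seteqP; split=> w; rewrite /B /= Fk /= !in_itv /= gt_max lt_min.
      by move=> [/andP[-> ->] /andP[-> ->]].
    by move=> /andP[/andP[-> ->] /andP[-> ->]].
  split; first exact: open_itv_measurable.
  rewrite Fk wlength_itv /= lte_fin.
  have [ab|ab] := ltP (Num.max a (- r)) (Num.min b r); last first.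
    rewrite (_ : [set w | _] = set0) ?measure0; last first.
      by apply/seteqP; split=> // w /= /andP[/lt_trans H /H]; rewrite ltNge ab.
    by case: ifP => [|_]; rewrite ?mule0// -EFinB -EFinM lee_fin => ba;
      rewrite mulr_ge0// subr_ge0 ltW.
  have a1 : a <= Num.max a (- r) by rewrite le_max lexx.
  have b1 : Num.min b r <= b by rewrite ge_min lexx.
  rewrite (le_lt_trans a1 (lt_le_trans ab b1)) -EFinB -EFinM.
  rewrite -[P _]fineK ?fin_num_measure//; last exact: open_itv_measurable.
  rewrite lee_fin; apply: (le_trans (bound _ _ _ (ltW ab) _)).
  - by rewrite le_max lexx orbT.
  - by rewrite ge_min lexx orbT.
  - by rewrite ler_wpM2l// lerB.
apply: (@le_trans _ _ (\sum_(k <oo) P (B k))%E).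
  apply: measure_sigma_subadditive => //.
    by move=> k; exact: (Bk k).1.
  move=> w /= Aw; have [k _ Fw] := AF _ Aw; exists k => //.
  by split=> //; have := Ar _ Aw; rewrite /= in_itv.
apply: (@le_trans _ _ (\sum_(k <oo) C%:E * wlength idfun (F k))%E).
  by apply: lee_nneseries => // k _; exact: (Bk k).2.
rewrite nneseriesZl; last by move=> k _; exact: wlength_ge0.
apply: (le_trans (lee_wpmul2l _ (ltW sumF))); first by rewrite lee_fin.
rewrite -EFinM lee_fin mulrCA -[leRHS]mulr1 ler_pM2l//.
by rewrite ler_pdivrMr ?mul1r ?lerDl// ltr_wpDl.
Qed.

Lemma C2_bounded (R : realType) (f : R -> R) (a b : R) :
  C2_on_positive f -> 0 < a ->
  exists2 K, 0 <= K & forall s, a <= s <= b -> f s <= K.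
Proof.
move=> fC2 a0; have [ab|ab] := leP a b; last first.
  by exists 0 => // s /andP[/le_trans H /H]; rewrite leNgt ab.
have cf : {within `[a, b], continuous f}.
  apply: derivable_within_continuous => x; rewrite in_itv /= => /andP[ax _].
  by case: (fC2 x (lt_le_trans a0 ax)) => dx _ _; exact: dx.
have [c _ fc] := EVT_max ab cf.
exists (Num.max 0 (f c)); first by rewrite le_max lexx.
by move=> s sab; rewrite le_max fc ?orbT// in_itv.
Qed.

(** Any point of the open interval is at distance more than [3 v delta] from
    its ends for a small [delta], and the rate is bounded on [[delta, t]]. *)
Lemma telegraph_null (R : realType) (v : R) (rate : R -> R)
    (d : measure_display) (T : measurableType d) (P : probability T R)
    (U : R -> T -> R) (t : R) (A : set R) :
  0 < v -> (forall t : R, 0 < t -> 0 <= rate t) -> C2_on_positive rate ->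
  is_telegraph_process P v (fun s => rate s / 2) U -> 0 < t ->
  measurable A -> lebesgue_measure A = 0%E -> A `<=` `]- (v * t), v * t[ ->
  P (U t @^-1` A) = 0%E.
Proof.
move=> v0 rate0 rateC2 HU t0 mA A0 Avt.
have mU := telegraph_measurable (ltW v0) rate0 HU (ltW t0).
pose r k := v * (t - 3 * k.+1%:R^-1).
pose B k := A `&` `]- r k, r k[.
have AB : A = \bigcup_k B k.
  apply/seteqP; split=> x; last by move=> [k _ []].
  move=> Ax; have := Avt x Ax; rewrite /= in_itv /= => /andP[x1 x2].
  have xv : `|x| < v * t by rewrite ltr_norml x1.
  have g0 : 0 < (v * t - `|x|) / (3 * v) by rewrite divr_gt0 ?subr_gt0// mulr_gt0.
  have [k _ /(_ k (leqnn k)) /= kg] := near_infty_natSinv_lt (PosNum g0).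
  have {}kg : k.+1%:R^-1 * (3 * v) < v * t - `|x|.
    by rewrite -ltr_pdivlMr// mulr_gt0.
  exists k => //; split=> //=; rewrite in_itv /= -ltr_norml /r.
  have -> : v * (t - 3 * k.+1%:R^-1) = v * t - k.+1%:R^-1 * (3 * v) by ring.
  by rewrite ltrBrDr addrC -ltrBrDr.
have mB k : measurable (B k) by apply: measurableI.
rewrite AB preimage_bigcup; apply/eqP; rewrite eq_le measure_ge0 andbT.
have mUB k : measurable (U t @^-1` B k).
  by rewrite -[X in measurable X]setTI; exact: mU.
apply: (@le_trans _ _ (\sum_(k <oo) P (U t @^-1` B k))%E).
  apply: measure_sigma_subadditive => //; exact: bigcup_measurable.
rewrite eseries0// => k _ _.
have dl0 : 0 < k.+1%:R^-1 :> R by rewrite invr_gt0.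
have [K K0 rateK] := C2_bounded t rateC2 dl0.
have C0 : 0 <= K / (2 * v) by rewrite divr_ge0// mulr_ge0// ltW.
apply: (null_preimage_of_interval_bound (r := r k) mU C0 _ (mB k)).
- move=> a b ra ab br.
  exact: (telegraph_interval_bound v0 rate0 HU t0 dl0 K0 rateK).
- apply/eqP; rewrite eq_le measure_ge0 andbT -A0.
  by apply: le_measure; rewrite ?inE; [exact: mB|exact: mA|move=> x []].
- by move=> x [].
Qed.

(** * Densities *)

(** Tonelli on the half plane below the diagonal: the two triangles of the
    square carry the same mass. *)
Lemma square_integral_triangle (R : realType) (q : R -> \bar R) :
  measurable_fun [set: R] q -> (forall u, 0%R <= q u)%E ->
  ((\int[lebesgue_measure]_u q u) * (\int[lebesgue_measure]_u q u) =
   (\int[lebesgue_measure]_u (q u * \int[lebesgue_measure]_(w in `]-oo, u]) q w)) +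
   (\int[lebesgue_measure]_u (q u * \int[lebesgue_measure]_(w in `]-oo, u]) q w)))%E.
Proof.
have disj (u : R) : [disjoint `]-oo, u]%classic & `]u, +oo[%classic].
  apply/disj_setPS => w [/=]; rewrite !in_itv /= andbT => wu.
  by rewrite ltNge wu.
have UE (u : R) : `]-oo, u] `|` `]u, +oo[ = [set: R].
  apply/seteqP; split=> w //= _; rewrite !in_itv /= andbT.
  by apply/orP; rewrite leNgt orbC orbN.
move=> mq q0.
have mle : measurable_fun [set: R * R] (fun z : R * R => z.2 <= z.1).
  exact: measurable_fun_ler measurable_snd measurable_fst.
pose h (z : R * R) : \bar R := (if (z.2 <= z.1)%R then q z.1 * q z.2 else 0)%E.
have mh : measurable_fun [set: R * R] h.
  apply: measurable_fun_ifT => //; apply: emeasurable_funM.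
    exact: measurableT_comp mq measurable_fst.
  exact: measurableT_comp mq measurable_snd.
have h0 z : (0%R <= h z)%E by rewrite /h; case: ifP => // _; rewrite mule_ge0.
have inner u : (\int[lebesgue_measure]_w h (u, w) =
    q u * \int[lebesgue_measure]_(w in `]-oo, u]) q w)%E.
  rewrite -ge0_integralZl//; last exact: measurable_funTS.
  rewrite [RHS]integral_mkcond; apply: eq_integral => w _.
  by rewrite patchE mem_setE in_itv.
have outer w : (\int[lebesgue_measure]_u h (u, w) =
    q w * \int[lebesgue_measure]_(u in `[w, +oo[) q u)%E.
  rewrite -ge0_integralZl//; last exact: measurable_funTS.
  rewrite [RHS]integral_mkcond; apply: eq_integral => u _.
  by rewrite patchE mem_setE in_itv /= andbT /h /= muleC.
have tonelli : (\int[lebesgue_measure]_u (q u * \int[lebesgue_measure]_(w in `]-oo, u]) q w) =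
    \int[lebesgue_measure]_u (q u * \int[lebesgue_measure]_(w in `[u, +oo[) q w))%E.
  transitivity (\int[lebesgue_measure]_u \int[lebesgue_measure]_w h (u, w))%E.
    by apply: eq_integral => u _; rewrite inner.
  rewrite (@fubini_tonelli _ _ _ _ _ lebesgue_measure lebesgue_measure h mh h0).
  by apply: eq_integral => u _; rewrite outer.
have mI1 : measurable_fun [set: R]
    (fun u => q u * \int[lebesgue_measure]_(w in `]-oo, u]) q w)%E.
  rewrite (_ : (fun u => _) = (fun u => \int[lebesgue_measure]_w h (u, w))%E); last first.
    by apply/funext => u; rewrite inner.
  exact: (measurable_fun_fubini_tonelli_F (m2 := lebesgue_measure) h mh h0).
have mI2 : measurable_fun [set: R]
    (fun u => q u * \int[lebesgue_measure]_(w in `[u, +oo[) q w)%E.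
  rewrite (_ : (fun u => _) = (fun w => \int[lebesgue_measure]_u h (u, w))%E); last first.
    by apply/funext => u; rewrite outer.
  exact: (measurable_fun_fubini_tonelli_G (m1 := lebesgue_measure) h mh h0).
have J0 (A : set R) : (0%R <= \int[lebesgue_measure]_(w in A) q w)%E.
  by apply: integral_ge0 => w _; exact: q0.
pose F1 u := (q u * \int[lebesgue_measure]_(w in `]-oo, u]) q w)%E.
pose F2 u := (q u * \int[lebesgue_measure]_(w in `[u, +oo[) q w)%E.
have F10 u : [set: R] u -> (0%R <= F1 u)%E by move=> _; exact: mule_ge0 (q0 u) (J0 _).
have F20 u : [set: R] u -> (0%R <= F2 u)%E by move=> _; exact: mule_ge0 (q0 u) (J0 _).
transitivity (\int[lebesgue_measure]_u F1 u + \int[lebesgue_measure]_u F2 u)%E; last first.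
  have F21 : (\int[lebesgue_measure]_u F2 u = \int[lebesgue_measure]_u F1 u)%E.
    exact: esym tonelli.
  by rewrite F21.
rewrite -(ge0_integralD lebesgue_measure measurableT F10 mI1 F20 mI2).
rewrite -(ge0_integralZr lebesgue_measure measurableT mq (fun u _ => q0 u)
  (J0 _)).
apply: eq_integral => u _; rewrite /F1 /F2.
rewrite -(ge0_muleDr _ (J0 _) (J0 _)); congr (_ * _)%E.
rewrite -(integral_itv_obnd_cbnd (b := +oo%O) (r := u)); last exact: measurable_funTS.
have mqU : measurable_fun (`]-oo, u] `|` `]u, +oo[) q by rewrite (UE u).
rewrite -(ge0_integral_setU lebesgue_measure (measurable_itv _) (measurable_itv _)
  mqU (fun w _ => q0 w) (disj u)).
by rewrite (UE u).
Qed.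

(** The image of Lebesgue measure under halving is twice Lebesgue measure. *)
Lemma ge0_integral_half (R : realType) (g : R -> \bar R) (D : set R) :
  measurable D -> measurable_fun D g -> (forall u, D u -> 0%R <= g u)%E ->
  (\int[lebesgue_measure]_(x in (fun x => (x / 2)%R) @^-1` D) g (x / 2)%R =
   2%:E * \int[lebesgue_measure]_(x in D) g x)%E.
Proof.
move=> mD mg g0.
pose phi (x : measurableTypeR R) : measurableTypeR R := x / 2.
have mphi : measurable_fun [set: measurableTypeR R] phi.
  by apply: measurable_funM.
have two0 : 0 <= (2 : R) by [].
have := @ge0_integral_pushforward _ _ _ _ R phi mphi lebesgue_measure D g mD mg.
have gD : {in D, forall y, (0%R <= g y)%E} by move=> y /set_mem; exact: g0.
move=> /(_ gD) <-.
rewrite -[2%:E]/((NngNum two0)%:num%:E) -ge0_integral_mscale//.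
apply: eq_measure_integral => //= A mA _.
have half0 : 0 <= (2^-1 : R) by rewrite invr_ge0.
rewrite /mscale /= (@lebesgue_measure_unique R
  (mscale (NngNum half0) (pushforward lebesgue_measure phi)) _ A mA).
  by rewrite /mscale /= muleA -EFinM divff// mul1e.
move=> _ [[a b] _ <-].
have preE : phi @^-1` `]a, b]%classic = `](a * 2), (b * 2)]%classic.
  by apply/seteqP; split=> x /=; rewrite !in_itv /= ltr_pdivlMr// ler_pdivrMr.
transitivity ((2^-1)%:E * lebesgue_measure `](a * 2)%R, (b * 2)%R]%classic)%E;
  last by rewrite -preE.
rewrite !lebesgue_measure_itv /= !lte_fin.
rewrite ltr_pM2r//; case: ifP => _; last by rewrite mule0.
by rewrite -!EFinB -EFinM; congr EFin; field.
Qed.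

(** The singular component charges only a null set, whose part inside [D] has
    probability [0]. *)
Lemma ac_density_on (R : realType) (d : measure_display)
    (T : measurableType d) (P : probability T R) (X : T -> R) (p : R -> R)
    (D : set R) :
  is_ac_density P X p ->
  (forall A, measurable A -> lebesgue_measure A = 0%E -> A `<=` D ->
     P (X @^-1` A) = 0%E) ->
  forall A, measurable A -> A `<=` D ->
    P (X @^-1` A) = (\int[lebesgue_measure]_(x in A) (p x)%:E)%E.
Proof.
move=> [mp [p0 [nu [[S [mS S0 nuS]] law]]]] null A mA AD.
rewrite law//; suff -> : nu A = 0%E by rewrite adde0.
have mAS : measurable (A `&` S) by exact: measurableI.
have AS0 : lebesgue_measure (A `&` S) = 0%E.
  apply/eqP; rewrite eq_le measure_ge0 andbT -S0.
  by apply: le_measure; rewrite ?inE//; exact: subIsetr.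
have nuAS : nu (A `&` S) = 0%E.
  have := law _ mAS; rewrite null//; last by move=> x [Ax _]; exact: AD.
  have int0 : (0%R <= \int[lebesgue_measure]_(x in A `&` S) (p x)%:E)%E.
    by apply: integral_ge0 => x _; rewrite lee_fin.
  move=> /esym/eqP; rewrite padde_eq0// => /andP[_ /eqP].
  exact.
have nuAnS : nu (A `\` S) = 0%E.
  apply/eqP; rewrite eq_le measure_ge0 andbT -nuS.
  by apply: le_measure; rewrite ?inE; [exact: measurableD|exact: measurableC|
    move=> x []].
rewrite -(setUIDK A S) measureU//.
- by rewrite [X in (X + _)%E]nuAS [X in (_ + X)%E]nuAnS adde0.
- exact: measurableD.
- by apply/seteqP; split=> // x [[_ Sx] [_ nSx]].
Qed.

(** The law is symmetric without atom at [0], so that each open half line has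
    mass [1 / 2]. *)
Lemma telegraph_half_line (R : realType) (v : R) (rate : R -> R)
    (d : measure_display) (T : measurableType d) (P : probability T R)
    (U : R -> T -> R) (t x : R) :
  0 < v -> (forall t : R, 0 < t -> 0 <= rate t) -> C2_on_positive rate ->
  is_telegraph_process P v (fun s => rate s / 2) U -> 0 < t -> 0 <= x ->
  fine (P (U t @^-1` `[0, x])) = fine (P [set w | U t w <= x]) - 2^-1 /\
  fine (P [set w | `|U t w| <= x]) = (fine (P [set w | U t w <= x]) - 2^-1) * 2.
Proof.
move=> v0 rate0 rateC2 HU t0 x0.
have mU := telegraph_measurable (ltW v0) rate0 HU (ltW t0).
have mle y := measurable_le_level mU y.
have sym y := (telegraph_distribution y (ltW v0) rate0 HU HU (ltW t0)).2.
have mlt y : measurable [set w | U t w < y].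
  rewrite (_ : [set w | _] = setT `&` U t @^-1` `]-oo, y[); first by apply: mU.
  by apply/seteqP; split=> w /=; rewrite in_itv /= => // -[].
have ltE y : fine (P [set w | U t w < - y]) = 1 - fine (P [set w | U t w <= y]).
  rewrite -sym -fine_probability_setC; last first.
    rewrite (_ : [set w | _] = ~` [set w | U t w < - y]); first exact: measurableC.
    by apply/seteqP; split=> w /=; rewrite lerNl leNgt => /negP.
  congr (fine (P _)); apply/seteqP; split=> w /=; rewrite lerNl ltNge.
    by move=> /negP.
  by move=> /negP.
have diff (y z : R) : y <= z -> fine (P [set w | y <= U t w <= z]) =
    fine (P [set w | U t w <= z]) - fine (P [set w | U t w < y]).
  move=> yz; have -> : [set w | y <= U t w <= z] =
      [set w | U t w <= z] `\` [set w | U t w < y].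
    apply/seteqP; split=> w /=.
      by move=> /andP[yU ->]; split=> //; apply/negP; rewrite -leNgt.
    by move=> [-> /negP]; rewrite -leNgt andbT.
  rewrite measureD//; last by rewrite -ge0_fin_numE// fin_num_measure.
  rewrite setIidr; last by move=> w /= /ltW /le_trans; apply.
  by rewrite fineB// fin_num_measure.
have atom : P [set w | U t w = 0] = 0%E.
  have -> : [set w | U t w = 0] = U t @^-1` [set 0] by [].
  apply: (telegraph_null v0 rate0 rateC2 HU t0) => //.
    exact: lebesgue_measure_set1.
  by move=> _ ->; rewrite /= in_itv /= oppr_lt0 mulr_gt0.
have half : fine (P [set w | U t w < 0]) = 2^-1.
  have := ltE 0; rewrite oppr0.
  have -> : [set w | U t w <= 0] = [set w | U t w < 0] `|` [set w | U t w = 0].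
    apply/seteqP; split=> w /=; rewrite le_eqVlt.
      by move=> /predU1P[|]; [right|left].
    by move=> [->|->]; rewrite ?orbT ?eqxx.
  have m0 : measurable [set w | U t w = 0].
    rewrite (_ : [set w | _] = setT `&` U t @^-1` [set 0]); first by apply: mU.
    by rewrite setTI.
  rewrite measureU//; last first.
    by apply/seteqP; split=> // w [/= + U0]; rewrite U0 ltxx.
  rewrite [X in (_ + X)%E]atom adde0; lra.
split.
  by rewrite -half -diff.
have -> : [set w | `|U t w| <= x] = [set w | - x <= U t w <= x].
  by apply/seteqP; split=> w /=; rewrite ler_norml.
rewrite diff; last by rewrite lerNl (le_trans _ x0)// oppr_le0.
by rewrite ltE; lra.
Qed.

Lemma measure_eq_of_tails (R : realType)
    (m1 m2 : {measure set (measurableTypeR R) -> \bar R}) :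
  (m1 setT < +oo)%E ->
  (forall x : R, m1 `]x, +oo[%classic = m2 `]x, +oo[%classic) ->
  forall A, measurable A -> m1 A = m2 A.
Proof.
move=> m1fin tails A mA.
apply: (@measure_unique _ R (measurableTypeR R) (@RGenOInfty.G R)
  (fun k => `](- k%:R), +oo[%classic) _ _ _ _ m1 m2 _ _ A mA).
- exact: RGenOInfty.measurableE.
- move=> _ _ [x ->] [y ->]; exists (Num.max x y); apply/seteqP; split=> z /=;
    rewrite !in_itv /= !andbT gt_max; [by move=> [-> ->]|by move=> /andP[]].
- by move=> k; exists (- k%:R).
- apply/seteqP; split=> // x _; exists (Num.truncn `|x|).+1 => //=.
  rewrite in_itv /= andbT ltrNl (le_lt_trans _ (truncnS_gt _))//.
  by rewrite -normrN ler_norm.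
- by move=> _ [x ->].
- move=> k; apply: le_lt_trans m1fin; apply: le_measure; rewrite ?inE//.
Qed.

(** Restricted to [[0, r]] with [r < b], the measures are finite and agree on
    all tails; then [r] increases to [b]. *)
Lemma measure_eq_of_initial_segments (R : realType)
    (m1 m2 : {measure set (measurableTypeR R) -> \bar R}) (b : R) :
  (forall z, 0 <= z < b -> m1 `[0, z]%classic = m2 `[0, z]%classic) ->
  (forall z, 0 <= z < b -> (m1 `[0%R, z]%classic < +oo)%E) ->
  forall A, measurable A -> A `<=` `[0, b[%classic -> m1 A = m2 A.
Proof.
move=> m12 m1fin A mA Ab.
have seg z : z < b -> m1 `[0, z]%classic = m2 `[0, z]%classic /\
    (m1 `[0%R, z]%classic < +oo)%E.
  move=> zb; have [z0|z0] := leP 0 z.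
    by split; [apply: m12|apply: m1fin]; rewrite z0.
  by rewrite set_itv_ge ?bnd_simp -?ltNge// !measure0; split.
have restr r B : r < b -> measurable B -> m1 (B `&` `[0, r]) = m2 (B `&` `[0, r]).
  move=> rb mB.
  have mr : measurable (`[0, r]%classic : set (measurableTypeR R)).
    exact: measurable_itv.
  apply: (@measure_eq_of_tails R (mrestr m1 mr) (mrestr m2 mr)) => //.
    by rewrite /= /mrestr setTI; exact: (seg r rb).2.
  move=> x; rewrite /= /mrestr.
  have -> : `]x, +oo[ `&` `[0, r] = `[0, r] `\` `[0, x].
    apply/seteqP; split=> z /=; rewrite !in_itv /= andbT.
      by move=> [xz ->]; split=> //; apply/negP; rewrite negb_and -!ltNge xz orbT.
    by move=> [/andP[z0 zr]]; rewrite z0 zr /= => /negP; rewrite -ltNge.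
  have mx : measurable (`[0, x]%classic : set (measurableTypeR R)).
    exact: measurable_itv.
  have r2 : (m2 `[0%R, r]%classic < +oo)%E by rewrite -(seg r rb).1 (seg r rb).2.
  have min_set : `[0, r] `&` `[0, x] = `[0, Num.min r x]%classic :> set R.
    apply/seteqP; split=> z /=; rewrite !in_itv /= le_min.
      by move=> [/andP[-> ->] /andP[_ ->]].
    by move=> /andP[-> /andP[-> ->]].
  rewrite [LHS](measureD mr mx (seg r rb).2) [RHS](measureD mr mx r2).
  congr (_ - _)%E; first exact: (seg r rb).1.
  rewrite min_set; apply: (seg (Num.min r x) _).1.
  by rewrite gt_min rb.
pose F k := A `&` `[0, b - k.+1%:R^-1].
have mF k : measurable (F k).
  by apply: measurableI => //; exact: measurable_itv.
have AF : \bigcup_k F k = A.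
  apply/seteqP; split=> [x [k _ []]//|x Ax].
  have := Ab x Ax; rewrite /= in_itv /= => /andP[x0 xb].
  have xb0 : 0 < b - x by rewrite subr_gt0.
  have [k _ /(_ k (leqnn k)) /= kx] := near_infty_natSinv_lt (PosNum xb0).
  exists k => //; split=> //=; rewrite in_itv /= x0 lerBrDr addrC -lerBrDr.
  exact: ltW.
have ndF : nondecreasing_seq F.
  move=> i j ij; apply/subsetPset => x [Ax /=]; rewrite in_itv /= => /andP[x0 xi].
  split=> //=; rewrite in_itv /= x0 (le_trans xi)// lerB// lef_pV2 ?posrE//.
  by rewrite ler_nat.
have mUF : measurable (\bigcup_k F k) by rewrite AF.
have c1 := @nondecreasing_cvg_mu _ _ _ m1 F mF mUF ndF.
have c2 := @nondecreasing_cvg_mu _ _ _ m2 F mF mUF ndF.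
have m12F : m1 \o F = m2 \o F.
  apply/funext => k; apply: restr => //.
  by rewrite ltrBlDr ltrDl invr_gt0.
rewrite m12F AF in c1; rewrite AF in c2.
exact: (cvg_unique _ c1 c2).
Qed.

Lemma law_density_of_distribution (R : realType) (d : measure_display)
    (T : measurableType d) (P : probability T R) (Z : T -> R) (f : R -> R) (b : R) :
  measurable_fun setT Z -> (forall w, 0 <= Z w) ->
  measurable_fun [set: R] f -> (forall x, 0 <= f x) ->
  (forall z, 0 <= z < b ->
     P [set w | Z w <= z] = (\int[lebesgue_measure]_(x in `[0%R, z]) (f x)%:E)%E) ->
  forall A, measurable A -> A `<=` `[0, b[ ->
    P (Z @^-1` A) = (\int[lebesgue_measure]_(x in A) (f x)%:E)%E.
Proof.
move=> mZ Z0 mf f0 law A mA Ab.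
pose Zr : T -> measurableTypeR R := Z.
have mZr : measurable_fun setT Zr by exact: mZ.
have mfE : measurable_fun [set: R] (EFin \o f) by exact/measurable_EFinP.
have fE0 x : (0%R <= (EFin \o f) x)%E by rewrite lee_fin.
pose dens (B : set (measurableTypeR R)) := (\int[lebesgue_measure]_(x in B) (f x)%:E)%E.
have dens0 : dens set0 = 0%E by exact: integral_set0.
have dens_ge0 B : (0%R <= dens B)%E.
  by apply: integral_ge0 => x _; exact: fE0.
have dens_add : semi_sigma_additive dens.
  exact: (@semi_sigma_additive_nng_induced _ _ _ lebesgue_measure _ mfE fE0).
pose m2 : {measure set (measurableTypeR R) -> \bar R} :=
  HB.pack dens (isMeasure.Build _ _ _ dens dens0 dens_ge0 dens_add).
(* the measure structure of the pushforward takes the measurability of Zr *)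
pose push : {measure set (measurableTypeR R) -> \bar R} := pushforward P Zr.
pose m1 : {measure set (measurableTypeR R) -> \bar R} := push mZr.
have seg z : 0 <= z < b -> m1 `[0, z]%classic = m2 `[0, z]%classic.
  move=> zb; rewrite /= -[RHS](law z zb); congr (P _).
  by apply/seteqP; split=> w /=; rewrite in_itv /= Z0.
apply: (@measure_eq_of_initial_segments R m1 m2 b seg) => //.
move=> z _; apply: (@le_lt_trans _ _ 1%E); last exact: ltry.
have mz : measurable (Z @^-1` `[0, z]) by rewrite -[X in measurable X]setTI; exact: mZ.
exact: probability_le1 mz.
Qed.

(** The integrand is formally the derivative of [(2 M (x / 2))^2].  As [M] is
    only an indefinite integral of [p], the identity is read off the two
    triangles of the square of side [z / 2] ([square_integral_triangle]). *)
Lemma integral_square_density (R : realType) (p M : R -> R) (z : R) :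
  measurable_fun [set: R] p -> (forall u, 0 <= p u) ->
  measurable_fun [set: R] M -> (forall u, 0 <= M u) -> 0 <= z ->
  (forall u, 0 <= u <= z / 2 ->
    (\int[lebesgue_measure]_(w in `[0%R, u]) (p w)%:E)%E = (M u)%:E) ->
  (\int[lebesgue_measure]_(x in `[0%R, z]) (4 * p (x / 2)%R * M (x / 2)%R)%:E)%E =
  ((M (z / 2) * 2) ^+ 2)%:E.
Proof.
move=> mp p0 mM M0 z0 pM.
have x0 : 0 <= z / 2 by rewrite divr_ge0.
have [x xE] : exists x, x = z / 2 by exists (z / 2).
rewrite -xE in x0 pM *.
pose g u := (4 * p u * M u)%:E.
have mpM : measurable_fun [set: R] (fun u => p u * M u) by exact: measurable_funM.
have preE : (fun y : R => y / 2) @^-1` `[0, x]%classic = `[0, z]%classic.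
  by apply/seteqP; split=> y /=; rewrite !in_itv /= xE ler_pdivlMr// mul0r
    ler_pM2r ?invr_gt0.
have mg : measurable_fun `[0, x] g.
  apply: measurable_funTS; apply/measurable_EFinP.
  apply: measurable_funM => //; exact: measurable_funM.
have g0 u : `[0, x]%classic u -> (0%R <= g u)%E.
  by move=> _; rewrite lee_fin !mulr_ge0.
have := ge0_integral_half (measurable_itv _) mg g0; rewrite preE => ->.
have -> : (\int[lebesgue_measure]_(u in `[0%R, x]) g u =
    4%:E * \int[lebesgue_measure]_(u in `[0%R, x]) (p u * M u)%:E)%E.
  rewrite -ge0_integralZl//.
  - by apply: eq_integral => u _; rewrite /g -mulrA EFinM.
  - by apply: measurable_funTS; exact/measurable_EFinP.
  - by move=> u _; rewrite lee_fin mulr_ge0.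
pose q := (EFin \o p) \_ `[0, x].
have mq : measurable_fun [set: R] q.
  apply/(measurable_restrictT _ (measurable_itv _)).
  by apply: measurable_funTS; exact/measurable_EFinP.
have q0 u : (0%R <= q u)%E.
  by rewrite /q patchE; case: ifP => // _; rewrite lee_fin.
have := square_integral_triangle mq q0.
rewrite -integral_mkcond pM; last by rewrite x0 lexx.
have -> : (\int[lebesgue_measure]_u (q u * \int[lebesgue_measure]_(w in `]-oo, u]) q w) =
    \int[lebesgue_measure]_(u in `[0%R, x]) (p u * M u)%:E)%E.
  rewrite [RHS]integral_mkcond; apply: eq_integral => u _; rewrite patchE {1}/q patchE.
  case: ifPn => [|_]; last exact: mul0e.
  rewrite mem_setE in_itv /= => /andP[u0 ux].
  rewrite /q -integral_mkcondr.
  rewrite (_ : `]-oo, u] `&` `[0, x] = `[0, u]%classic); last first.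
    apply/seteqP; split=> w /=; rewrite !in_itv /=.
      by move=> [-> /andP[->]].
    by move=> /andP[-> wu]; rewrite wu (le_trans wu).
  by rewrite pM ?u0// -EFinM.
move=> {pM}; case: (\int[_]_(_ in _) _)%E => [j| |] //.
rewrite -!EFinM -EFinD => -[e]; congr EFin; lra.
Qed.

Theorem mainTheorem4 (R : realType) (c : R) (lambda : R -> R)
    (c_gt0 : 0 < c)
    (lambda_ge0 : forall t : R, 0 < t -> 0 <= lambda t)
    (lambda_C2 : C2_on_positive lambda)
    (d : measure_display) (T : measurableType d) (P : probability T R)
    (X Y : R -> T -> R)
    (XY_motion : is_orthogonal_planar_motion P c lambda X Y)
    (d' : measure_display) (T' : measurableType d') (Q : probability T' R)
    (U V : R -> T' -> R)
    (U_telegraph :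
      is_telegraph_process Q (c / 2) (fun t => lambda t / 2) U)
    (V_telegraph :
      is_telegraph_process Q (c / 2) (fun t => lambda t / 2) V)
    (UV_indep : independent_processes Q U V)
    (pU pV : R -> R -> R)
    (pU_density : forall t : R, 0 <= t -> is_ac_density Q (U t) (fun x => pU x t))
    (pV_density : forall t : R, 0 <= t -> is_ac_density Q (V t) (fun x => pV x t)) :
  let Z := l1_distance X Y in
  forall t : R, 0 <= t ->
    has_density_on P (Z t) `[0, c * t[
      (fun z => 4 * pU (z / 2) t *
                \int[lebesgue_measure]_(w in `[0, z / 2]) pV w t) /\
    (forall beta : R, 0 <= beta <= c * t ->
       P [set w | running_max Z t w <= beta] =
       (Q [set w | (running_max (fun s w' => `|U s w'|) t w <= beta / 2)%R]
          ^+ 2)%E).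
Proof.
move=> Z t t_ge0.
have [mZ lawZ lawZmax] :=
  square_distribution (ltW c_gt0) lambda_ge0 XY_motion U_telegraph t_ge0.
split; last by move=> beta _; exact: lawZmax.
have [mpU [pU0 _]] := pU_density t t_ge0.
have [mpV [pV0 [nu [_ lawV]]]] := pV_density t t_ge0.
pose M x := \int[lebesgue_measure]_(w in `[0, x]) pV w t.
have M0 x : 0 <= M x by apply: Rintegral_ge0.
have pVfin x : (\int[lebesgue_measure]_(w in `[0%R, x]) (pV w t)%:E)%E \is a fin_num.
  have mx : measurable (`[0, x]%classic : set R) by exact: measurable_itv.
  have int0 : (0%R <= \int[lebesgue_measure]_(w in `[0%R, x]) (pV w t)%:E)%E.
    by apply: integral_ge0 => w _; rewrite lee_fin.
  have mV := telegraph_measurable (ltW (divr_gt0 c_gt0 (ltr0Sn _ 1))) lambda_ge0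
    V_telegraph t_ge0.
  rewrite ge0_fin_numE//; apply: (@le_lt_trans _ _ 1%E); last exact: ltry.
  have mVx : measurable (V t @^-1` `[0, x]).
    by rewrite -[X in measurable X]setTI; exact: mV.
  apply: le_trans (probability_le1 Q mVx); rewrite lawV//.
  by rewrite leeDl.
have mM : measurable_fun [set: R] M.
  apply: nondecreasing_measurable => // x y xy; apply: fine_le => //.
  apply: ge0_subset_integral => //.
  - by apply: measurable_funTS; exact/measurable_EFinP.
  - by move=> w _; rewrite lee_fin.
  - by apply: subset_itvl; rewrite bnd_simp.
have mf : measurable_fun [set: R] (fun z => 4 * pU (z / 2) t * M (z / 2)).
  have mhalf : measurable_fun [set: R] (fun z : R => z / 2) by exact: measurable_funM.
  apply: measurable_funM.
    apply: measurable_funM => //; exact: (measurableT_comp mpU mhalf).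
  exact: (measurableT_comp mM mhalf).
have f0 z : 0 <= 4 * pU (z / 2) t * M (z / 2) by rewrite !mulr_ge0.
split; first exact: measurable_funTS.
split=> // A mA AD.
apply: (law_density_of_distribution mZ _ mf f0 _ mA AD).
  by move=> w; rewrite /Z /l1_distance addr_ge0.
move=> z /andP[z0 zct].
have t_gt0 : 0 < t by rewrite -(pmulr_rgt0 _ c_gt0) (le_lt_trans z0).
have v0 : 0 < c / 2 by rewrite divr_gt0.
have nullU A' := @telegraph_null _ _ _ _ _ Q U t A' v0 lambda_ge0 lambda_C2
  U_telegraph t_gt0.
have nullV A' := @telegraph_null _ _ _ _ _ Q V t A' v0 lambda_ge0 lambda_C2
  V_telegraph t_gt0.
have acU := ac_density_on (pU_density t t_ge0) nullU.
have acV := ac_density_on (pV_density t t_ge0) nullV.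
have sub u : u <= z / 2 -> `[0, u]%classic `<=` `]- (c / 2 * t), c / 2 * t[%classic.
  move=> uz y /=; rewrite !in_itv /= => /andP[y0 yu]; apply/andP; split.
    by rewrite (lt_le_trans _ y0)// oppr_lt0 mulr_gt0.
  by rewrite (le_lt_trans yu)// (le_lt_trans uz)// mulrAC ltr_pM2r// invr_gt0.
have mU := telegraph_measurable (ltW v0) lambda_ge0 U_telegraph t_ge0.
have line W u (HW : is_telegraph_process Q (c / 2) (fun t => lambda t / 2) W)
    (u0 : 0 <= u) := telegraph_half_line v0 lambda_ge0 lambda_C2 HW t_gt0 u0.
(* U and V have the same law, so that M is also an integral of pU *)
have MU u : 0 <= u <= z / 2 -> Q (U t @^-1` `[0, u]) = (M u)%:E.
  move=> /andP[u0 uz]; rewrite /M /Rintegral -acV//; last exact: sub.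
  have [eU _] := line U u U_telegraph u0.
  have [eV _] := line V u V_telegraph u0.
  have [eUV _] := telegraph_distribution u (ltW v0) lambda_ge0 U_telegraph V_telegraph
    t_ge0.
  rewrite eV -eUV -eU fineK//; apply: fin_num_measure.
  by rewrite -[X in measurable X]setTI; exact: mU.
have pM u : 0 <= u <= z / 2 ->
    (\int[lebesgue_measure]_(w in `[0%R, u]) (pU w t)%:E)%E = (M u)%:E.
  by move=> uz; rewrite -MU// -acU//; apply: sub; case/andP: uz.
have z20 : 0 <= z / 2 by rewrite divr_ge0.
rewrite (integral_square_density mpU pU0 mM M0 z0 pM) lawZ.
have [eU eU2] := line U _ U_telegraph z20.
rewrite -[Q _]fineK; last first.
  apply: fin_num_measure; apply: measurable_le_level.
  exact: measurableT_comp mU.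
rewrite -EFin_expe; congr (_ ^+ 2)%:E; rewrite eU2 -eU MU//.
by rewrite z20 lexx.
Qed.
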